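(* Let $V:=\mathbb Q[\mathbb N_{\ge1}]$ be the free $\mathbb Q$-vector space on the positive integers, and let $T(V)=\bigoplus_{n\in\mathbb N}V^{\otimes n}$ with concatenation product, denoted $\clubsuit$, so that words $n_1\clubsuit n_2\clubsuit\cdots\clubsuit n_k$ in positive integers form a linear basis. Let $\Phi:(T(V),\clubsuit)\to(\mathcal H_{\mathrm{int}},\bullet)$ be the unique homomorphism of associative unital algebras with $\Phi(n)=\{\{1,2,\dots,n\}\}$ for $n\in\mathbb N_{\ge1}$. Then $\Phi$ is a linear isomorphism, mapping the basis of words bijectively onto $\mathbf{StIP}$. Moreover, define a product on $T(V)$ by $v\,\spadesuit_{\mathrm{wrd}}\,w:=\Phi^{-1}(\Phi(v)\spadesuit\Phi(w))$, and let $\Delta_{\spadesuit_{\mathrm{wrd}}}$ and $\Delta_\clubsuit$ (deconcatenation) be the coproducts dual to $\spadesuit_{\mathrm{wrd}}$ and $\clubsuit$ with respect to the basis of words. Then $(T(V),\clubsuit,\Delta_{\spadesuit_{\mathrm{wrd}}})$ is a bialgebra, and $(T(V),\spadesuit_{\mathrm{wrd}},\Delta_\clubsuit)$ is a connected filtered Hopf algebra, filtered by the length of words.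
   Context: $\mathbb N=\{0,1,2,\dots\}$, $\mathbb N_{\ge1}=\{1,2,\dots\}$, $[n]=\{1,\dots,n\}$, $[0]=\emptyset$. For a finite set $A\subset\mathbb N_{\ge1}$, an interval partition of $A$ is a finite set $\mathcal I$ of non-empty pairwise disjoint sets (blocks) with union $A$, each block being an interval of $\mathbb N_{\ge1}$ (a set of consecutive integers $\{a,a+1,\dots,b\}$). $\mathbf{IP}(A)$ is the set of these ($\mathbf{IP}(\emptyset)=\{\emptyset\}$), $\mathbf{IP}=\bigcup_A\mathbf{IP}(A)$, and $\bigcup\mathcal I$ denotes the ground set of $\mathcal I$. $\mathbf{StIP}_n:=\mathbf{IP}([n])$, $\mathbf{StIP}:=\bigcup_{n}\mathbf{StIP}_n$. Standardization: for $\mathcal I\in\mathbf{IP}$ with $|\bigcup\mathcal I|=n$, $\mathbf{std}(\mathcal I)\in\mathbf{StIP}_n$ is the image of $\mathcal I$, block by block, under the unique order-preserving bijection $\bigcup\mathcal I\to[n]$. Gluing: for $\mathcal I,\mathcal J\in\mathbf{IP}$, let $\sim$ be the smallest equivalence relation on the set of blocks $\mathcal I\cup\mathcal J$ such that $E\sim F$ whenever $E\cap F\neq\emptyset$. Then $\mathcal I\cdot_{\mathrm{glue}}\mathcal J:=\{\bigcup_{X\in[T]_\sim}X\mid T\in\mathcal I\cup\mathcal J\}$. $\mathcal H_{\mathrm{int}}$ is the free $\mathbb Q$-vector space on $\mathbf{StIP}$. The product $\bullet$ is given by: $\mathfrak s\bullet\mathfrak t$ consists of the blocks of $\mathfrak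 s$ together with the blocks of $\mathfrak t$ translated by $|\bigcup\mathfrak s|$ (unit $\emptyset$). The product $\spadesuit$ is $\mathfrak s\spadesuit\mathfrak t:=\sum_{\mathfrak g\in\mathbf{StIP}}\langle\mathfrak s\otimes\mathfrak t,\Delta_\spadesuit(\mathfrak g)\rangle\,\mathfrak g$ (pairing making basis elements orthonormal), where $\Delta_\spadesuit(\mathfrak g):=\sum_{A\cup A'=\bigcup\mathfrak g}\ \sum_{\mathcal I\in\mathbf{IP}(A),\,\mathcal I'\in\mathbf{IP}(A'),\ \mathcal I\cdot_{\mathrm{glue}}\mathcal I'=\mathfrak g}\mathbf{std}(\mathcal I)\otimes\mathbf{std}(\mathcal I')$ (outer sum over ordered pairs of not necessarily disjoint subsets). The unit of both structures on $T(V)$ is the empty word and the counit is $1$ on the empty word and $0$ on all other words. A bialgebra is filtered by subspaces $F_0\subset F_1\subset\cdots$ with union the whole space if $F_p\cdot F_q\subset F_{p+q}$ and $\Delta(F_n)\subset\sum_{p+q=n}F_p\otimes F_q$, and connected if $F_0$ is one-dimensional; here $F_n=\bigoplus_{k\le n}V^{\otimes k}$. *)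

(* Defs.v *)
From HB Require Import structures.
From mathcomp Require Import all_boot all_order all_algebra.
From mathcomp Require Import finmap monalg.
From mathcomp Require Import classical_sets cardinality fsbigop.

Set Implicit Arguments.
Unset Strict Implicit.
Unset Printing Implicit Defensive.

Import GRing.Theory.

Local Open Scope fset_scope.
Local Open Scope nat_scope.

Definition itv (a b : nat) : {fset nat} := [fset i in iota a (b.+1 - a)].

Definition seg (n : nat) : {fset nat} := itv 1 n.

Definition is_interval (E : {fset nat}) : bool :=
  [exists a : E, exists b : E, E == itv (val a) (val b)].

(* Interval partitions are only used with a ground set A contained in some    *)
(* [seg n], so that 0 is never in A.                                         *)
Definition is_ip (A : {fset nat}) (I : {fset {fset nat}}) : bool :=
  [&& fcover I == A, trivIfset I, fset0 \notin I & all is_interval I].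

Definition IP (A : {fset nat}) : {fset {fset {fset nat}}} :=
  [fset I in fpowerset (fpowerset A) | is_ip A I].

(* Standardness: the ground set is [seg n] for some n, see [is_stdP].         *)
Definition is_std (I : {fset {fset nat}}) : bool :=
  is_ip (seg #|` fcover I|) I.

Record stip := Stip { stip_val :> {fset {fset nat}}; stip_valP : is_std stip_val }.

HB.instance Definition _ := [isSub for stip_val].
HB.instance Definition _ := [Choice of stip by <:].

Lemma in_itv a b x : (x \in itv a b) = (a <= x <= b).
Proof.
rewrite !inE mem_iota; case: (leqP a x) => //= ax.
have [ab|ba] := leqP a b; first by rewrite subnKC ?ltnS // ltnW.
have -> : b.+1 - a = 0 by apply/eqP; rewrite subn_eq0.
by rewrite addn0 ltnNge ax /= leqNgt (leq_trans ba ax).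
Qed.

Lemma in_seg n x : (x \in seg n) = (0 < x <= n).
Proof. exact: in_itv. Qed.

Lemma card_seg n : #|` seg n| = n.
Proof.
rewrite /seg /itv card_fseq undup_id ?iota_uniq // size_iota.
by rewrite subSS subn0.
Qed.

Lemma is_intervalP E :
  reflect (exists a b, a <= b /\ E = itv a b) (is_interval E).
Proof.
apply: (iffP existsP) => [[a /existsP [b /eqP eE]]|[a [b [ab eE]]]].
  exists (val a), (val b); split=> //.
  have : val a \in itv (val a) (val b) by rewrite -eE; apply: valP.
  by rewrite in_itv => /andP[].
have aE : a \in E by rewrite eE in_itv leqnn.
have bE : b \in E by rewrite eE in_itv leqnn andbT.
by exists [` aE]; apply/existsP; exists [` bE]; rewrite /= eE.
Qed.

Lemma in_fcover (x : nat) (I : {fset {fset nat}}) : reflect (exists2 E, E \in I & x \in E) (x \in fcover I).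
Proof.
rewrite /fcover.
apply: (iffP (bigfcupP _ _ _ _)) => [[E /andP[EI _] xE]|[E EI xE]].
  by exists E.
by exists E; rewrite ?EI.
Qed.

Lemma is_ipP A I : reflect
  [/\ fcover I = A, {in I &, forall E F, E != F -> [disjoint E & F]}
    & {in I, forall E, is_interval E}] (is_ip A I).
Proof.
apply: (iffP and4P) => [[/eqP cI tI _ /allP iI]|[cI tI iI]].
  by split=> //; apply/trivIfsetP.
split; [exact/eqP|exact/trivIfsetP| |exact/allP].
apply/negP => /iI /is_intervalP[a [b [ab e0]]].
by have := in_itv a b a; rewrite -e0 !inE leqnn ab.
Qed.

Lemma mem_IP A I : (I \in IP A) = is_ip A I.
Proof.
rewrite !inE /= andb_idl // => /is_ipP[cI _ _].
rewrite fpowersetE; apply/fsubsetP => E EI; rewrite fpowersetE.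
by apply/fsubsetP => x xE; rewrite -cI; apply/in_fcover; exists E.
Qed.

Lemma is_stdP I : reflect (exists n, is_ip (seg n) I) (is_std I).
Proof.
apply: (iffP idP) => [|[n In]]; first by exists #|` fcover I|.
by rewrite /is_std; case/is_ipP: (In) => -> _ _; rewrite card_seg.
Qed.

Lemma is_ip_imfset (f : nat -> nat) (A : {fset nat}) (I : {fset {fset nat}}) :
    {in A &, injective f} ->
    {in I, forall E : {fset nat}, is_interval (f @` E)} -> is_ip A I ->
  is_ip (f @` A) [fset f @` (E : {fset nat}) | E in I].
Proof.
move=> injf fI /is_ipP[cI tI _].
have sub E x : E \in I -> x \in E -> x \in A.
  by move=> EI xE; rewrite -cI; apply/in_fcover; exists E.
apply/is_ipP; split.
- apply/fsetP => y; apply/in_fcover/imfsetP => [|[x /= xA ->]].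
    case=> _ /imfsetP[E /= EI ->] /imfsetP[x /= xE ->].
    by exists x => //; apply: sub xE.
  move: xA; rewrite -cI => /in_fcover[E EI xE].
  by exists (f @` E); apply: in_imfset.
- move=> _ _ /imfsetP[E /= EI ->] /imfsetP[F /= FI ->] nEF.
  have dEF : [disjoint E & F] by apply: tI => //; apply: contraNneq nEF => ->.
  apply/fdisjointP => _ /imfsetP[x /= xE ->]; apply/negP => /imfsetP[y /= yF].
  move=> /(injf _ _ (sub _ _ EI xE) (sub _ _ FI yF)) exy.
  by move/fdisjointP: dEF => /(_ _ xE); rewrite exy yF.
- by move=> _ /imfsetP[E /= EI ->]; apply: fI.
Qed.

Lemma is_ipU (A B : {fset nat}) (I J : {fset {fset nat}}) : [disjoint A & B] -> is_ip A I -> is_ip B J ->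
  is_ip (A `|` B) (I `|` J).
Proof.
move=> dAB /is_ipP[cI tI iI] /is_ipP[cJ tJ iJ].
have dIJ E F : E \in I -> F \in J -> [disjoint E & F].
  move=> EI FJ; apply/fdisjointP => x xE; apply/negP => xF.
  have xA : x \in A by rewrite -cI; apply/in_fcover; exists E.
  have xB : x \in B by rewrite -cJ; apply/in_fcover; exists F.
  by move/fdisjointP: dAB => /(_ _ xA); rewrite xB.
apply/is_ipP; split.
- apply/fsetP => x; rewrite inE -cI -cJ; apply/in_fcover/orP.
    by case=> E; rewrite inE => /orP[] EIJ xE;
      [left|right]; apply/in_fcover; exists E.
  by case=> /in_fcover[E EIJ xE]; exists E; rewrite // inE EIJ ?orbT.
- move=> E F; rewrite !inE => /orP[EI|EJ] /orP[FI|FJ] nEF.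
  + exact: tI.
  + exact: dIJ.
  + by rewrite fdisjoint_sym dIJ.
  + exact: tJ.
- by move=> E; rewrite inE => /orP[/iI|/iJ].
Qed.

Lemma stip0_subproof : is_std fset0.
Proof.
apply/is_stdP; exists 0; apply/is_ipP; split; last by move=> E; rewrite inE.
  apply/fsetP => x; apply/in_fcover/idP => [[E]|]; first by rewrite inE.
  by rewrite in_seg; case: x.
by move=> E F; rewrite inE.
Qed.

Definition stip0 : stip := Stip stip0_subproof.

Notation posn := {n : nat | 0 < n}.

Lemma block_subproof (n : posn) : is_std [fset seg (val n)].
Proof.
apply/is_stdP; exists (val n); apply/is_ipP; split.
- apply/fsetP => x; apply/in_fcover/idP => [[E]|xn].
    by rewrite inE => /eqP ->.
  by exists (seg (val n)) => //; apply: fset11.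
- by move=> E F; rewrite !inE => /eqP -> /eqP ->; rewrite eqxx.
- move=> E; rewrite inE => /eqP ->; apply/is_intervalP.
  by exists 1, (val n); split=> //; apply: (valP n).
Qed.

Definition block (n : posn) : stip := Stip (block_subproof n).

Definition shift (m : nat) (E : {fset nat}) : {fset nat} :=
  [fset x + m | x in E].

Definition bullet_val (s t : {fset {fset nat}}) : {fset {fset nat}} :=
  s `|` [fset shift #|` fcover s| E | E in t].

Lemma shift_itv m a b : shift m (itv a b) = itv (a + m) (b + m).
Proof.
apply/fsetP => y; rewrite in_itv; apply/imfsetP/idP => [[x /=]|].
  by rewrite in_itv => /andP[ax xb] ->; rewrite !leq_add2r ax.
move=> /andP[ay yb]; have my : m <= y by apply: leq_trans ay; rewrite leq_addl.
exists (y - m); last by rewrite subnK.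
by rewrite /= in_itv -(leq_add2r m) -[_ <= b](leq_add2r m) !subnK // ay.
Qed.

Lemma bullet_subproof (s t : stip) : is_std (bullet_val s t).
Proof.
case: s t => [s ss] [t st]; rewrite /bullet_val /=; set m := #|` _|.
apply/is_stdP; exists (m + #|` fcover t|).
have -> : seg (m + #|` fcover t|) = seg m `|` shift m (seg #|` fcover t|).
  apply/fsetP => x; rewrite /seg shift_itv add1n addnC in_fsetU !in_itv.
  case: (leqP x m) => [xm|mx] /=; last by rewrite andbF (leq_ltn_trans _ mx).
  by rewrite (leq_trans xm) ?leq_addl // andbT orbF.
apply: is_ipU => //.
  apply/fdisjointP => x; rewrite /seg shift_itv add1n !in_itv => /andP[_ xm].
  by rewrite ltnNge xm.
apply: is_ip_imfset => // [x y _ _ /addIn //|E Et].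
case/is_ipP: st => _ _ /(_ E Et) /is_intervalP[a [b [ab ->]]].
apply/is_intervalP; exists (a + m), (b + m).
by split; [rewrite leq_add2r|exact: shift_itv].
Qed.

Definition bullet_basis (s t : stip) : stip := Stip (bullet_subproof s t).

(* On [A], [rank A] is the order-preserving bijection onto [seg #|`A|]; see  *)
(* [rank_mono] and [rank_imfset].                                            *)
Definition rank (A : {fset nat}) (x : nat) : nat :=
  #|` [fset y in A | y <= x]|.

Definition std_val (A : {fset nat}) (I : {fset {fset nat}}) :=
  [fset rank A @` (E : {fset nat}) | E in I].

Lemma rankS (A : {fset nat}) x : rank A x.+1 = rank A x + (x.+1 \in A).
Proof.
rewrite /rank addnC; case: (boolP (x.+1 \in A)) => xA /=.
  have -> : [fset y in A | y <= x.+1] = x.+1 |` [fset y in A | y <= x].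
    apply/fsetP => y; rewrite !inE /= leq_eqVlt ltnS.
    by case: eqP => [->|]; rewrite ?xA.
  by rewrite cardfsU1 !inE /= ltnn andbF.
rewrite add0n; congr #|` _|; apply/fsetP => y; rewrite !inE /= leq_eqVlt ltnS.
by case: eqP => [->|]; rewrite ?(negPf xA).
Qed.

Lemma leq_rank (A : {fset nat}) x y : x <= y -> rank A x <= rank A y.
Proof.
elim: y => [|y IH]; first by rewrite leqn0 => /eqP ->.
rewrite leq_eqVlt ltnS => /orP[/eqP -> //|/IH le].
by rewrite rankS (leq_trans le) ?leq_addr.
Qed.

Lemma ltn_rank (A : {fset nat}) x y : y \in A -> x < y -> rank A x < rank A y.
Proof.
case: y => // y yA; rewrite ltnS rankS yA addn1 ltnS; exact: leq_rank.
Qed.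

Lemma rank_mono (A : {fset nat}) : {in A &, {mono rank A : x y / x <= y}}.
Proof.
move=> x y xA yA; have [xy|yx] := leqP x y; first exact: leq_rank.
by rewrite leqNgt ltn_rank.
Qed.

Lemma rank_inj (A : {fset nat}) : {in A &, injective (rank A)}.
Proof.
move=> x y xA yA e; apply/eqP.
by rewrite eqn_leq -(rank_mono xA yA) -(rank_mono yA xA) e leqnn.
Qed.

Lemma rank_imfset (A : {fset nat}) : rank A @` A = seg #|` A|.
Proof.
have cE : #|` rank A @` A| = #|` A| by apply: card_in_imfset; apply: rank_inj.
apply/eqP; rewrite eqEfcard card_seg cE leqnn andbT; apply/fsubsetP => _ /imfsetP[x /= xA ->].
rewrite in_seg cardfs_gt0; apply/andP; split.
  by apply/fset0Pn; exists x; rewrite !inE /= xA leqnn.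
by apply: fsubset_leq_card; apply/fsubsetP => y; rewrite !inE => /andP[].
Qed.

Lemma rank_itv (A : {fset nat}) a b : a <= b -> itv a b `<=` A ->
  rank A @` itv a b = itv (rank A a) (rank A b).
Proof.
move=> ab /fsubsetP sA.
have rE i : a + i <= b -> rank A (a + i) = rank A a + i.
  elim: i => [|i IH]; first by rewrite !addn0.
  rewrite addnS => ib; rewrite rankS IH 1?ltnW // sA ?addn1 ?addnS //.
  by rewrite in_itv ib andbT leqW ?leq_addr.
have rbE : rank A b = rank A a + (b - a) by rewrite -rE subnKC.
apply/fsetP => y; rewrite in_itv rbE; apply/imfsetP/idP => [[x /=]|].
  rewrite in_itv => /andP[ax xb] ->; rewrite -(subnKC ax) rE ?subnKC //.
  by rewrite leq_addr leq_add2l leq_sub2r.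
move=> /andP[ay yb]; have yab : y - rank A a <= b - a by rewrite leq_subLR.
have le : a + (y - rank A a) <= b by rewrite -(subnKC ab) leq_add2l.
by exists (a + (y - rank A a)); rewrite /= ?in_itv ?leq_addr // rE // subnKC.
Qed.

Lemma std_ip A (I : IP A) : is_ip (seg #|` A|) (std_val A (val I)).
Proof.
case: I => /= I; rewrite mem_IP => AI.
rewrite -rank_imfset; apply: is_ip_imfset => //; first exact: rank_inj.
case/is_ipP: AI => cI _ iI E EI.
have /is_intervalP[a [b [ab eE]]] := iI _ EI.
apply/is_intervalP; exists (rank A a), (rank A b).
split; first exact: leq_rank.
rewrite eE rank_itv //; apply/fsubsetP => x xE.
by rewrite -cI; apply/in_fcover; exists E; rewrite // eE.
Qed.

Lemma std_subproof A (I : IP A) : is_std (std_val A (val I)).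
Proof. by apply/is_stdP; exists #|` A|; apply: std_ip. Qed.

Definition std (A : {fset nat}) (I : IP A) : stip := Stip (std_subproof I).

(* [connect] is the reflexive transitive closure; the overlap relation being *)
(* symmetric, it is the smallest equivalence relation containing it, see      *)
(* [glue_equiv] and [glue_min].                                              *)
Definition overlap (B : {fset {fset nat}}) : rel B :=
  fun E F => val E `&` val F != fset0.

Definition glue (I J : {fset {fset nat}}) : {fset {fset nat}} :=
  [fset \bigcup_(F | connect (@overlap (I `|` J)) E F) val F
     | E : I `|` J].

Lemma glue_equiv (B : {fset {fset nat}}) : equivalence_rel (connect (@overlap B)).
Proof.
apply/equivalence_relP; split; first exact: connect0.
have sym : connect_sym (@overlap B).
  by apply: sym_connect_sym => E F; rewrite /overlap fsetIC.
move=> E F EF G; apply/idP/idP; last exact: connect_trans.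
by apply: connect_trans; rewrite sym.
Qed.

Lemma glue_min (B : {fset {fset nat}}) (r : rel B) : equivalence_rel r ->
  subrel (@overlap B) r -> subrel (connect (@overlap B)) r.
Proof.
move=> /equivalence_relP[rr rt] sr E F /connectP[p + ->].
elim: p E => [|G p IH] E /=; first by rewrite rr.
by move=> /andP[/sr EG /IH]; rewrite -(rt _ _ EG).
Qed.

Local Open Scope ring_scope.

(* {malg rat[K]} is the free Q-vector space on K; the tensor product of the  *)
(* free spaces on K and L is the free space on K * L.                        *)

Definition linext (K : choiceType) (M : lmodType rat) (f : K -> M)
    (x : {malg rat[K]}) : M :=
  \sum_(k <- msupp x) x@_k *: f k.

Lemma linextU (K : choiceType) (M : lmodType rat) (f : K -> M) k :
  linext f << k >> = f k.
Proof.
by rewrite /linext msuppU oner_eq0 big_seq_fset1 mcoeffUU scale1r.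
Qed.

Section FreeSpaces.
Variables (K L : choiceType).

Definition bilext (M : lmodType rat) (f : K -> L -> M)
    (x : {malg rat[K]}) (y : {malg rat[L]}) : M :=
  linext (fun k => linext (f k) y) x.

Definition tens (x : {malg rat[K]}) (y : {malg rat[L]}) :
    {malg rat[(K * L)%type]} :=
  bilext (fun k l => << (k, l) >>) x y.

Lemma tensU k l : tens << k >> << l >> = << (k, l) >>.
Proof. by rewrite /tens /bilext !linextU. Qed.

Definition pairing (x y : {malg rat[K]}) : rat :=
  \sum_(k <- msupp x) x@_k * y@_k.

Lemma pairingU k y : pairing << k >> y = y@_k.
Proof.
by rewrite /pairing msuppU oner_eq0 big_seq_fset1 mcoeffUU mul1r.
Qed.

Definition subspace (P : {malg rat[K]} -> Prop) : Prop :=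
  P 0 /\ forall a x y, P x -> P y -> P (a *: x + y).

End FreeSpaces.

Definition tensmap (K L K' L' : choiceType)
    (f : {malg rat[K]} -> {malg rat[K']}) (g : {malg rat[L]} -> {malg rat[L']}) :
    {malg rat[(K * L)%type]} -> {malg rat[(K' * L')%type]} :=
  linext (fun p => tens (f << p.1 >>) (g << p.2 >>)).

Definition tens_space (K L : choiceType) (P : {malg rat[K]} -> Prop)
    (Q : {malg rat[L]} -> Prop) (z : {malg rat[(K * L)%type]}) : Prop :=
  exists s : seq ({malg rat[K]} * {malg rat[L]}),
    {in s, forall u, P u.1 /\ Q u.2} /\ z = \sum_(u <- s) tens u.1 u.2.

Section Bialgebras.
Variable K : choiceType.
Local Notation H := {malg rat[K]}.
Local Notation H2 := {malg rat[(K * K)%type]}.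

Implicit Types (mul : H -> H -> H) (one : H) (D : H -> H2) (eps : H -> rat).
Implicit Types (S : H -> H) (F : nat -> H -> Prop).

Record is_algebra mul one : Prop := IsAlgebra {
  alg_linearl : forall y, linear (mul^~ y);
  alg_linearr : forall x, linear (mul x);
  alg_mulA : associative mul;
  alg_mul1l : left_id one mul;
  alg_mulr1 : right_id one mul }.

Definition tensA :
    {malg rat[(K * K * K)%type]} -> {malg rat[(K * (K * K))%type]} :=
  linext (fun p => << (p.1.1, (p.1.2, p.2)) >>).

Record is_coalgebra D eps : Prop := IsCoalgebra {
  coalg_linear : linear D;
  coalg_scalar : scalar eps;
  coalg_coassoc : forall x, tensA (tensmap D id (D x)) = tensmap id D (D x);
  coalg_counitl : forall x,
    linext (fun p => eps << p.1 >> *: << p.2 >>) (D x) = x;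
  coalg_counitr : forall x,
    linext (fun p => eps << p.2 >> *: << p.1 >>) (D x) = x }.

(* (a (x) b) (c (x) d) = ac (x) bd *)
Definition tensmul mul : H2 -> H2 -> H2 :=
  bilext (fun p q => tens (mul << p.1 >> << q.1 >>) (mul << p.2 >> << q.2 >>)).

Record is_bialgebra mul one D eps : Prop := IsBialgebra {
  bialg_alg : is_algebra mul one;
  bialg_coalg : is_coalgebra D eps;
  bialg_coprodM : forall x y, D (mul x y) = tensmul mul (D x) (D y);
  bialg_coprod1 : D one = tens one one;
  bialg_counitM : forall x y, eps (mul x y) = eps x * eps y;
  bialg_counit1 : eps one = 1 }.

Record is_antipode mul one D eps S : Prop := IsAntipode {
  antipode_linear : linear S;
  antipodel : forall x,
    linext (fun p => mul (S << p.1 >>) << p.2 >>) (D x) = eps x *: one;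
  antipoder : forall x,
    linext (fun p => mul << p.1 >> (S << p.2 >>)) (D x) = eps x *: one }.

Definition is_hopf mul one D eps : Prop :=
  is_bialgebra mul one D eps /\ exists S, is_antipode mul one D eps S.

Record is_filtered mul D F : Prop := IsFiltered {
  filt_subspace : forall n, subspace (F n);
  filt_le : forall n x, F n x -> F n.+1 x;
  filt_exhaustive : forall x, exists n, F n x;
  filt_mul : forall p q x y, F p x -> F q y -> F (p + q)%N (mul x y);
  filt_coprod : forall n x, F n x ->
    exists z : 'I_n.+1 -> H2,
      (forall p : 'I_n.+1, tens_space (F p) (F (n - p)%N) (z p)) /\
      D x = \sum_p z p }.

Definition is_connected F : Prop :=
  exists2 e : H, e != 0 & forall x, F 0%N x <-> exists c : rat, x = c *: e.

Definition dual_coproduct mul D : Prop :=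
  linear D /\
  forall x v w : H, pairing (D x) (tens v w) = pairing x (mul v w).

End Bialgebras.

Definition Hint := {malg rat[stip]}.

Definition bullet : Hint -> Hint -> Hint :=
  bilext (fun s t => << bullet_basis s t >>).

Definition Delta_spade (g : stip) : {malg rat[(stip * stip)%type]} :=
  \sum_(A <- fpowerset (fcover g))
  \sum_(A' <- fpowerset (fcover g) | (A `|` A')%fset == fcover g)
  \sum_(I : IP A)
  \sum_(I' : IP A' | glue (val I) (val I') == g) << (std I, std I') >>.

Lemma card_fcover_std (A : {fset nat}) (I : IP A) :
  #|` fcover (std I)| = #|` A|.
Proof. by case/is_ipP: (std_ip I) => /= -> _ _; rewrite card_seg. Qed.

Lemma Delta_spade_card s t g : (Delta_spade g)@_(s, t) != 0 ->
  (#|` fcover g| <= #|` fcover s| + #|` fcover t|)%N.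
Proof.
apply: contraR; rewrite -ltnNge => ltg; rewrite /Delta_spade raddf_sum /=.
apply/eqP; apply: big1 => A _; rewrite raddf_sum; apply: big1 => A' /eqP cA.
rewrite raddf_sum; apply: big1 => I _; rewrite raddf_sum; apply: big1 => I' _.
rewrite /= mcoeffU; case: eqP => // -[es et]; move: ltg.
by rewrite ltnNge -es -et !card_fcover_std -cA cardfsU leq_subr.
Qed.

Lemma spade_finite s t : finite_set
  [set g | pairing (tens << s >> << t >>) (Delta_spade g) != 0]%classic.
Proof.
set n := (#|` fcover s| + #|` fcover t|)%N.
pose B := fpowerset (fpowerset (seg n)).
have fB : finite_set ((@stip_val) @^-1` [set` B])%classic.
  apply: finite_preimage; last exact: finite_fset.
  by move=> g h _ _; apply: val_inj.
apply: sub_finite_set fB => g /=; rewrite tensU pairingU => /Delta_spade_card.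
rewrite -/n => gn; case/is_ipP: (stip_valP g) => cg _ _.
rewrite fpowersetE; apply/fsubsetP => E Eg; rewrite fpowersetE.
apply/fsubsetP => x xE.
have : x \in fcover g by apply/in_fcover; exists E.
by rewrite cg !in_seg => /andP[-> xg]; apply: leq_trans gn.
Qed.

(* The sum is finitely supported, by [spade_finite].                         *)
Definition spade_basis (s t : stip) : Hint :=
  \sum_(g \in [set: stip]%classic)
    pairing (tens << s >> << t >>) (Delta_spade g) *: << g >>.

Definition spade : Hint -> Hint -> Hint := bilext spade_basis.

(* The tensor algebra T(V) as the monoid algebra of the free monoid: words   *)
(* form a basis and the ring product is concatenation.                       *)
Definition word := {fmonom posn}.
Definition TV := {malg rat[word]}.

Definition is_Phi (Phi : TV -> Hint) : Prop :=
  [/\ Phi 1 = << stip0 >>, {morph Phi : v w / v * w >-> bullet v w}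
    & forall n : posn, Phi << FMonom [:: n] >> = << block n >>].

Definition deconc : TV -> {malg rat[(word * word)%type]} :=
  linext (fun w : word =>
    \sum_(i < (size w).+1) << (FMonom (take i w), FMonom (drop i w)) >>).

Definition counit (x : TV) : rat := x@_(FMonom [::]).

(* The direct sum of the k-th tensor powers of V for k <= n *)
Definition len_filtration (n : nat) (x : TV) : Prop :=
  {in msupp x, forall w : word, (size w <= n)%N}.

(* Main.v *)
(** Letter i of an interval partition with ground set in [n] records whether
    i+1 lies outside of the ground set (0), starts a block (1), or continues
    the block of i (2).  On such codes gluing is the pointwise maximum,
    standardization deletes the zeros, and the product of stips is
    concatenation.  Coassociativity and multiplicativity of the coproduct thus
    become statements on pairs of 0-1-2 words with a given pointwise maximum,
    proved letter by letter.  The second bialgebra is the dual of the first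
    one, and its antipode is computed by recursion on the length of words: the
    one-sided convolution inverses so obtained agree by associativity. *)

Require Import Defs.
From HB Require Import structures.
From mathcomp Require Import classical_sets cardinality fsbigop.
From mathcomp Require Import all_boot all_order all_algebra.
From mathcomp Require Import finmap monalg.

Set Implicit Arguments.
Unset Strict Implicit.
Unset Printing Implicit Defensive.

Import GRing.Theory.

Local Open Scope ring_scope.

(** * Duality and convolution on free spaces *)

(** Two obstacles stand against an argument letter by letter. The iterated coproduct deletes zeros
    between its two steps, so that the second decomposition no longer lines up with the first;
    [big_decs_nonzeros] puts the zeros back, after which both iterated coproducts are the same sum
    over triples of valid words with a given maximum. Validity concerns neighbouring letters: the
    recursions therefore carry the preceding letters along, and [decs_valid] makes the validity of
    an intermediate word automatic. Multiplicativity holds because the code of a nonempty standard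
    partition starts with 1, so that no factor of a decomposition continues a block across the seam.
    The product dual to the splits is never expanded; only its coefficients are known, and its laws
    are obtained by transposition. *)

Section LinearExtension.
Variables (K : choiceType) (M : lmodType rat).
Implicit Types (f g : K -> M) (x y : {malg rat[K]}).

(** The supports of [x], [y] and [a *: x + y] differ; a common superset makes the three sums
    comparable term by term. *)
Lemma linextEw f (d : {fset K}) x : (msupp x `<=` d)%fset ->
  linext f x = \sum_(k <- d) x@_k *: f k.
Proof.
move=> xd; rewrite /linext; apply: big_fset_incl => // k _ kx.
by rewrite mcoeff_outdom // scale0r.
Qed.

Lemma linext_linear f : linear (linext f).
Proof.
move=> a x y; pose d := (msupp x `|` msupp y)%fset.
have sx : (msupp x `<=` d)%fset by apply: fsubsetUl.
have sy : (msupp y `<=` d)%fset by apply: fsubsetUr.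
have sd : (msupp (a *: x + y) `<=` d)%fset.
  apply: fsubset_trans (msuppD_le _ _) _; rewrite fsubUset sy andbT.
  by apply: fsubset_trans (msuppZ_le _ _) sx.
rewrite (linextEw _ sx) (linextEw _ sy) (linextEw _ sd) scaler_sumr -big_split.
by apply: eq_bigr => k _; rewrite /= mcoeffD mcoeffZ scalerDl scalerA.
Qed.

HB.instance Definition _ f :=
  GRing.isLinear.Build rat {malg rat[K]} M _ (linext f) (linext_linear f).

Lemma eq_linext f g : f =1 g -> linext f =1 linext g.
Proof. by move=> fg x; apply: eq_bigr => k _; rewrite fg. Qed.

Lemma linextDf f g x : linext (fun k => f k + g k) x = linext f x + linext g x.
Proof. by rewrite /linext -big_split; apply: eq_bigr => k _; rewrite scalerDr. Qed.

Lemma linextZf a f x : linext (fun k => a *: f k) x = a *: linext f x.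
Proof.
rewrite /linext scaler_sumr; apply: eq_bigr => k _.
by rewrite !scalerA mulrC.
Qed.

Lemma malg_basisE x : linext (fun k => << k >>) x = x.
Proof.
rewrite /linext [RHS]monalgE; apply: eq_bigr => k _.
by apply/malgP => l; rewrite mcoeffZ !mcoeffU -mulr_natl mulrC; case: eqP => _;
  rewrite ?mulr1 ?mul1r ?mulr0 ?mul0r.
Qed.

(** Linearity is a hypothesis on bare functions because the maps compared later are mostly ad hoc
    lambda terms; they are bundled inside the proof. Scalar-valued maps are covered by
    [M := rat^o]. *)
Lemma eq_linear_basis (F G : {malg rat[K]} -> M) : linear F -> linear G ->
  (forall k, F << k >> = G << k >>) -> F =1 G.
Proof.
move=> lF lG FG x.
pose FL : {linear {malg rat[K]} -> M} :=
  HB.pack F (GRing.isLinear.Build rat {malg rat[K]} M _ F lF).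
pose GL : {linear {malg rat[K]} -> M} :=
  HB.pack G (GRing.isLinear.Build rat {malg rat[K]} M _ G lG).
rewrite -(malg_basisE x) /linext -[F _]/(FL _) -[G _]/(GL _) !linear_sum.
by apply: eq_bigr => k _; rewrite !linearZ /= FG.
Qed.

End LinearExtension.

Lemma linext_comp (K : choiceType) (M N : lmodType rat) (F : M -> N) (f : K -> M) x :
  linear F -> F (linext f x) = linext (fun k => F (f k)) x.
Proof.
move=> lF; apply: (eq_linear_basis (F := F \o linext f)) x => [a x y||k] /=.
- by rewrite linearP lF.
- exact: linext_linear.
- by rewrite !linextU.
Qed.

Section Bilinear.
Variables (K L : choiceType).

Lemma bilextPl (M : lmodType rat) (f : K -> L -> M) y : linear ((bilext f)^~ y).
Proof. exact: linext_linear. Qed.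

Lemma bilextPr (M : lmodType rat) (f : K -> L -> M) x : linear (bilext f x).
Proof.
move=> a y z; rewrite /bilext -linextZf -linextDf.
by apply: eq_linext => k; rewrite linearP.
Qed.

Lemma bilextU (M : lmodType rat) (f : K -> L -> M) k l :
  bilext f << k >> << l >> = f k l.
Proof. by rewrite /bilext !linextU. Qed.

Lemma eq_bilinear_basis (M : lmodType rat)
    (F G : {malg rat[K]} -> {malg rat[L]} -> M) :
  (forall y, linear (F^~ y)) -> (forall x, linear (F x)) ->
  (forall y, linear (G^~ y)) -> (forall x, linear (G x)) ->
  (forall k l, F << k >> << l >> = G << k >> << l >>) -> F =2 G.
Proof.
move=> Fl Fr Gl Gr FG x y.
apply: (eq_linear_basis (F := F^~ y) (G := G^~ y)) => // k.
exact: (eq_linear_basis (F := F << k >>) (G := G << k >>)).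
Qed.

Lemma tensPl y : linear ((@tens K L)^~ y). Proof. exact: bilextPl. Qed.
Lemma tensPr x : linear (@tens K L x). Proof. exact: bilextPr. Qed.

Lemma mcoeff_tens x y k l : (@tens K L x y)@_(k, l) = x@_k * y@_l.
Proof.
apply: (eq_bilinear_basis (M := rat^o)
  (F := fun x y => (tens x y)@_(k, l)) (G := fun x y => x@_k * y@_l))
  => {x y} [y a x z|x a y z|y a x z|x a y z|i j] /=.
- by rewrite tensPl mcoeffD mcoeffZ.
- by rewrite tensPr mcoeffD mcoeffZ.
- by rewrite mcoeffD mcoeffZ mulrDl -mulrA.
- by rewrite mcoeffD mcoeffZ mulrDr mulrCA.
- rewrite tensU !mcoeffU xpair_eqE; case: (i == k); case: (j == l);
    by rewrite ?mulr1 ?mulr0 ?mul0r.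
Qed.

End Bilinear.

Section Pairing.
Variable K : choiceType.
Implicit Types x y z : {malg rat[K]}.

Lemma pairingPl y : scalar ((@pairing K)^~ y).
Proof. exact: (linext_linear (M := rat^o) (fun k => y@_k : rat^o)). Qed.

Lemma pairingPr x : scalar (@pairing K x).
Proof.
move=> a y z; rewrite /pairing mulr_sumr -big_split.
by apply: eq_bigr => k _; rewrite /= mcoeffD mcoeffZ mulrDr mulrCA.
Qed.

Lemma pairingZl a x y : pairing (a *: x) y = a * pairing x y.
Proof.
have p0 : pairing 0 y = 0 by rewrite /pairing msupp0 big_seq_fset0.
by rewrite -[a *: x]addr0 pairingPl p0 addr0.
Qed.

Lemma pairingC x y : pairing x y = pairing y x.
Proof.
apply: (eq_bilinear_basis (M := rat^o)
  (F := @pairing K) (G := fun x y => pairing y x)) => {x y} [y|x|x|y|k l] /=.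
- exact: pairingPl.
- exact: pairingPr.
- exact: pairingPr.
- exact: pairingPl.
- by rewrite !pairingU !mcoeffU eq_sym.
Qed.

Lemma pairingUr x k : pairing x << k >> = x@_k.
Proof. by rewrite pairingC pairingU. Qed.

Lemma eq_pairing x y : (forall k, pairing x << k >> = pairing y << k >>) -> x = y.
Proof. by move=> xy; apply/malgP => k; rewrite -!pairingUr. Qed.

End Pairing.

Lemma pairing_tens (K L : choiceType) (x x' : {malg rat[K]}) (y y' : {malg rat[L]}) :
  pairing (tens x y) (tens x' y') = pairing x x' * pairing y y'.
Proof.
apply: (eq_bilinear_basis (M := rat^o)
  (F := fun x y => pairing (tens x y) (tens x' y'))
  (G := fun x y => pairing x x' * pairing y y'))
  => {x y} [y a x z|x a y z|y a x z|x a y z|i j] /=.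
- by rewrite tensPl pairingPl.
- by rewrite tensPr pairingPl.
- by rewrite pairingPl mulrDl -mulrA.
- by rewrite pairingPl mulrDr mulrCA.
- by rewrite tensU !pairingU mcoeff_tens.
Qed.

Lemma tensmap_linear (K L K' L' : choiceType) f g :
  linear (@tensmap K L K' L' f g).
Proof. exact: linext_linear. Qed.

Lemma tensmapU (K L K' L' : choiceType) f g k l :
  @tensmap K L K' L' f g << (k, l) >> = tens (f << k >>) (g << l >>).
Proof. by rewrite /tensmap linextU. Qed.

(** * Transposition of algebra and coalgebra structures *)

Section Duality.
Variable K : choiceType.
Local Notation H := {malg rat[K]}.
Local Notation H2 := {malg rat[(K * K)%type]}.

Section DualCoalgebra.
Variables (mul : H -> H -> H) (D : H -> H2).
Hypothesis dual : dual_coproduct mul D.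

(** This and the next three lemmas identify the coalgebra laws of [D] as transposes of the algebra
    laws of [mul]. Since [tensA] only re-brackets basis elements, [dual] applies once outside and
    once inside the left factor. *)
Lemma pairing_coassocl x u v w :
  pairing (tensA (tensmap D id (D x))) (tens u (tens v w)) =
  pairing x (mul (mul u v) w).
Proof.
have tA t : pairing (tensA t) (tens u (tens v w)) =
            pairing t (tens (tens u v) w).
  apply: (eq_linear_basis (M := rat^o)
    (F := fun t => pairing (tensA t) (tens u (tens v w)))
    (G := fun t => pairing t (tens (tens u v) w))) t => [a s t|a s t|[[a b] c]] /=.
  - by rewrite /tensA linearP pairingPl.
  - by rewrite pairingPl.
  - by rewrite /tensA linextU !pairingU !mcoeff_tens mulrA.
rewrite tA; case: dual => Dl DM; rewrite -DM.
apply: (eq_linear_basis (M := rat^o)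
  (F := fun z => pairing (tensmap D id z) (tens (tens u v) w))
  (G := fun z => pairing z (tens (mul u v) w))) => [a s t|a s t|[k l]] /=.
- by rewrite tensmap_linear pairingPl.
- by rewrite pairingPl.
- by rewrite tensmapU pairing_tens DM -pairing_tens tensU.
Qed.

Lemma pairing_coassocr x u v w :
  pairing (tensmap id D (D x)) (tens u (tens v w)) =
  pairing x (mul u (mul v w)).
Proof.
case: dual => Dl DM; rewrite -DM.
apply: (eq_linear_basis (M := rat^o)
  (F := fun z => pairing (tensmap id D z) (tens u (tens v w)))
  (G := fun z => pairing z (tens u (mul v w)))) => [a s t|a s t|[k l]] /=.
- by rewrite tensmap_linear pairingPl.
- by rewrite pairingPl.
- by rewrite tensmapU pairing_tens DM -pairing_tens tensU.
Qed.

Lemma pairing_counitl e x y :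
  pairing (linext (fun p => << p.1 >>@_e *: << p.2 >>) (D x)) y =
  pairing x (mul << e >> y).
Proof.
case: dual => Dl DM; rewrite -DM.
apply: (eq_linear_basis (M := rat^o)
  (F := fun z => pairing (linext (fun p => << p.1 >>@_e *: << p.2 >>) z) y)
  (G := fun z => pairing z (tens << e >> y))) => [a s t|a s t|[k l]] /=.
- by rewrite linearP pairingPl.
- by rewrite pairingPl.
- rewrite linextU /= pairingU mcoeff_tens pairingZl pairingU.
  by rewrite !mcoeffU eq_sym.
Qed.

Lemma pairing_counitr e x y :
  pairing (linext (fun p => << p.2 >>@_e *: << p.1 >>) (D x)) y =
  pairing x (mul y << e >>).
Proof.
case: dual => Dl DM; rewrite -DM.
apply: (eq_linear_basis (M := rat^o)
  (F := fun z => pairing (linext (fun p => << p.2 >>@_e *: << p.1 >>) z) y)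
  (G := fun z => pairing z (tens y << e >>))) => [a s t|a s t|[k l]] /=.
- by rewrite linearP pairingPl.
- by rewrite pairingPl.
- rewrite linextU /= pairingU mcoeff_tens pairingZl pairingU.
  by rewrite !mcoeffU eq_sym mulrC.
Qed.

End DualCoalgebra.

(** The exchange of the two middle tensor factors, which precedes the two multiplications in
    [tensmul]. It is an involution of the basis, hence self-adjoint. *)
Definition swap23 (z : {malg rat[((K * K) * (K * K))%type]}) :
    {malg rat[((K * K) * (K * K))%type]} :=
  linext (fun p => << ((p.1.1, p.2.1), (p.1.2, p.2.2)) >>) z.

Lemma pairing_swap23 t u : pairing (swap23 t) u = pairing t (swap23 u).
Proof.
apply: (eq_bilinear_basis (M := rat^o)
  (F := fun t u => pairing (swap23 t) u) (G := fun t u => pairing t (swap23 u)))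
  => {t u} [u a s t|t a s u|u|t a s u|[[a b] [c d]] [[a' b'] [c' d']]] /=.
- by rewrite /swap23 linearP pairingPl.
- by rewrite pairingPr.
- exact: pairingPl.
- by rewrite /swap23 linearP pairingPr.
- rewrite /swap23 !linextU /= !pairingU !mcoeffU !xpair_eqE.
  by rewrite -!andbA; congr (_ *+ nat_of_bool (_ && _)); rewrite andbCA.
Qed.

Lemma tensmulPl mul Y : linear ((@tensmul K mul)^~ Y).
Proof. exact: bilextPl. Qed.

Lemma tensmulPr mul X : linear (@tensmul K mul X).
Proof. exact: bilextPr. Qed.

Lemma tensmulU mul p q : @tensmul K mul << p >> << q >> =
  tens (mul << p.1 >> << q.1 >>) (mul << p.2 >> << q.2 >>).
Proof. exact: bilextU. Qed.

Lemma pairing_tensmul mul D (dual : dual_coproduct mul D) X Y x y :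
  pairing (tensmul mul X Y) (tens x y) =
  pairing (swap23 (tens X Y)) (tens (D x) (D y)).
Proof.
case: dual => Dl DM.
apply: (eq_bilinear_basis (M := rat^o)
  (F := fun X Y => pairing (tensmul mul X Y) (tens x y))
  (G := fun X Y => pairing (swap23 (tens X Y)) (tens (D x) (D y))))
  => {X Y} [Y a X Z|X a Y Z|Y a X Z|X a Y Z|[a b] [c d]] /=.
- by rewrite tensmulPl pairingPl.
- by rewrite tensmulPr pairingPl.
- by rewrite tensPl /swap23 linearP pairingPl.
- by rewrite tensPr /swap23 linearP pairingPl.
- rewrite tensmulU /swap23 tensU linextU /= pairing_tens pairingU mcoeff_tens.
  by rewrite -!pairingUr -!tensU !DM (pairingC x) (pairingC y).
Qed.

Variables (mul mul' : H -> H -> H) (D D' : H -> H2) (e : K).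
Hypothesis dual : dual_coproduct mul' D.
Hypothesis dual' : dual_coproduct mul D'.
Hypothesis linl : forall y, linear (mul'^~ y).
Hypothesis linr : forall x, linear (mul' x).

(** The bialgebra axioms are self-dual: associativity and coassociativity exchange roles, and so do
    unit and counit, both given by the same [e], once as a vector and once as a coefficient. *)
Lemma dual_bialgebra : is_bialgebra mul << e >> D (mcoeff e) ->
  is_bialgebra mul' << e >> D' (mcoeff e).
Proof.
case=> [[mll mlr mA m1l mr1] [Dl es coA cul cur] coM co1 cuM cu1].
have D'l : linear D' by case: dual'.
have DM : forall x v w, pairing (D x) (tens v w) = pairing x (mul' v w) by case: dual.
have DM' : forall x v w, pairing (D' x) (tens v w) = pairing x (mul v w)
  by case: dual'.
split.
- split=> //.
  + move=> u v w; apply: eq_pairing => k; rewrite !(pairingC _ << k >>).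
    by rewrite -(pairing_coassocr dual) -(pairing_coassocl dual) coA.
  + move=> y; apply: eq_pairing => k; rewrite !(pairingC _ << k >>).
    by rewrite -(pairing_counitl dual) cul.
  + move=> y; apply: eq_pairing => k; rewrite !(pairingC _ << k >>).
    by rewrite -(pairing_counitr dual) cur.
- split; [exact: D'l|exact: es| | |].
  + move=> x; apply: eq_pairing => -[a [b c]]; rewrite -!tensU.
    by rewrite (pairing_coassocr dual') (pairing_coassocl dual') mA.
  + by move=> x; apply: eq_pairing => k; rewrite (pairing_counitl dual') m1l.
  + by move=> x; apply: eq_pairing => k; rewrite (pairing_counitr dual') mr1.
- move=> x y; apply: eq_pairing => -[u v]; rewrite -tensU.
  (* Both sides become a pairing of [swap23] of one pair of coproducts, [D] of [u], [v] or [D'] of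
     [x], [y], with the other pair; self-adjointness of [swap23] and symmetry identify them. *)
  rewrite (DM' (mul' x y)) (pairingC (mul' x y)) -(DM (mul _ _) x y) coM.
  rewrite [LHS](pairing_tensmul dual') [RHS](pairing_tensmul dual).
  rewrite [LHS]pairing_swap23.
  exact: pairingC.
- apply: eq_pairing => -[u v]; rewrite -tensU DM' pairing_tens !pairingU.
  exact: cuM.
- by move=> x y; rewrite -!(pairingU e) -DM co1 pairing_tens.
- by rewrite mcoeffUU.
Qed.

End Duality.

(** * Convolution and one-sided antipodes *)

Section Convolution.
Variable K : choiceType.
Local Notation H := {malg rat[K]}.
Local Notation H2 := {malg rat[(K * K)%type]}.
Variables (mul : H -> H -> H) (one : H) (D : H -> H2) (eps : H -> rat).
Hypothesis algH : is_algebra mul one.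
Hypothesis coalgH : is_coalgebra D eps.
Implicit Types f g h : H -> H.

Definition conv f g x : H :=
  linext (fun p => mul (f << p.1 >>) (g << p.2 >>)) (D x).

Lemma conv_linear f g : linear (conv f g).
Proof.
by case: coalgH => Dl _ _ _ _ a x y; rewrite /conv Dl linearP.
Qed.

(** Evaluates a triple convolution on an iterated coproduct; both bracketings reduce to it, so that
    [convA] follows from coassociativity. *)
Definition conv3 f g h (z : {malg rat[(K * (K * K))%type]}) : H :=
  linext (fun p => mul (f << p.1 >>) (mul (g << p.2.1 >>) (h << p.2.2 >>))) z.

Lemma conv3_linear f g h : linear (conv3 f g h).
Proof. exact: linext_linear. Qed.

Lemma convEr f g h x : conv f (conv g h) x = conv3 f g h (tensmap id D (D x)).
Proof.
case: algH => ml mr _ _ _; rewrite /conv.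
apply: (eq_linear_basis
  (F := fun z => linext (fun p => mul (f << p.1 >>) (conv g h << p.2 >>)) z)
  (G := fun z => conv3 f g h (tensmap id D z))) => [|a y z|[k l]] /=.
- exact: linext_linear.
- by rewrite tensmap_linear conv3_linear.
rewrite tensmapU linextU /= /conv.
apply: (eq_linear_basis
  (F := fun z => mul (f << k >>)
           (linext (fun p => mul (g << p.1 >>) (h << p.2 >>)) z))
  (G := fun z => conv3 f g h (tens << k >> z))) => [a y z|a y z|[i j]] /=.
- by rewrite linearP mr.
- by rewrite tensPr conv3_linear.
- by rewrite tensU /conv3 !linextU.
Qed.

Lemma convEl f g h x :
  conv (conv f g) h x = conv3 f g h (tensA (tensmap D id (D x))).
Proof.
case: algH => ml mr mA _ _; rewrite /conv.
apply: (eq_linear_basis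
  (F := fun z => linext (fun p => mul (conv f g << p.1 >>) (h << p.2 >>)) z)
  (G := fun z => conv3 f g h (tensA (tensmap D id z)))) => [|a y z|[k l]] /=.
- exact: linext_linear.
- by rewrite tensmap_linear /tensA linearP conv3_linear.
rewrite tensmapU linextU /= /conv.
apply: (eq_linear_basis
  (F := fun z => mul (linext (fun p => mul (f << p.1 >>) (g << p.2 >>)) z)
           (h << l >>))
  (G := fun z => conv3 f g h (tensA (tens z << l >>)))) => [a y z|a y z|[i j]] /=.
- by rewrite linearP ml.
- by rewrite tensPl /tensA linearP conv3_linear.
- by rewrite tensU /conv3 /tensA !linextU /= mA.
Qed.

Lemma convA f g h x : conv (conv f g) h x = conv f (conv g h) x.
Proof. by case: coalgH => _ _ coA _ _; rewrite convEl convEr coA. Qed.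

Lemma conv_unitr f x : linear f -> conv f (fun y => eps y *: one) x = f x.
Proof.
case: algH => _ mr _ _ m1; case: coalgH => _ _ _ _ cur lf.
rewrite -[in RHS](cur x) linext_comp //; apply: eq_linext => p.
(* The linearity axiom speaks of [a *: x + y]; at [a = -1] and [x = y = 0] it gives the value at
   zero. *)
have m0 y : mul y 0 = 0.
  by have := mr y (-1) 0 0; rewrite scaler0 addr0 scaleN1r addNr.
have f0 : f 0 = 0 by have := lf (-1) 0 0; rewrite scaler0 addr0 scaleN1r addNr.
by rewrite -[_ *: one]addr0 mr m0 addr0 m1 -[_ *: << _ >>]addr0 lf f0 addr0.
Qed.

Lemma conv_unitl f x : linear f -> conv (fun y => eps y *: one) f x = f x.
Proof.
case: algH => ml _ _ m1 _; case: coalgH => _ _ _ cul _ lf.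
rewrite -[in RHS](cul x) linext_comp //; apply: eq_linext => p.
have m0 y : mul 0 y = 0.
  by have := ml y (-1) 0 0; rewrite scaler0 addr0 scaleN1r addNr.
have f0 : f 0 = 0 by have := lf (-1) 0 0; rewrite scaler0 addr0 scaleN1r addNr.
by rewrite -[_ *: one]addr0 ml m0 addr0 m1 -[_ *: << _ >>]addr0 lf f0 addr0.
Qed.

Lemma eq_conv f f' g g' : f =1 f' -> g =1 g' -> conv f g =1 conv f' g'.
Proof. by move=> ff gg x; apply: eq_linext => p; rewrite ff gg. Qed.

(** Left and right inverses in a monoid coincide: for convolution, [Sl] equals
    [conv Sl (conv id Sr)], that is [conv (conv Sl id) Sr], which is [Sr]. *)
Lemma antipode_of_one_sided Sl Sr : linear Sl -> linear Sr ->
  (forall x, conv Sl id x = eps x *: one) ->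
  (forall x, conv id Sr x = eps x *: one) -> is_antipode mul one D eps Sl.
Proof.
move=> lSl lSr Sl1 Sr1; have SlSr : Sl =1 Sr.
  move=> x; rewrite -(conv_unitr x lSl) -(conv_unitl x lSr).
  rewrite -(eq_conv (fun=> erefl) Sr1) -convA.
  exact: eq_conv.
split=> // x; rewrite -Sr1; apply: eq_linext => p.
by rewrite SlSr.
Qed.

End Convolution.

(** * Codes over the letters 0, 1, 2 *)

Local Open Scope nat_scope.

(* A block can only be continued inside the ground set. *)
Definition may_follow (j k : nat) : bool := (k == 2) ==> (j != 0).

(** The path starts at 0, so a code cannot begin with a 2: the integer 0 lies in no block. *)
Local Notation valid := (path may_follow 0).
Local Notation nonzeros x := [seq k <- x | k != 0].

Definition max_pairs (k : nat) : seq (nat * nat) :=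
  [seq p <- [seq (i, j) | i <- iota 0 3, j <- iota 0 3] | maxn p.1 p.2 == k].

(** Validity, a condition on neighbouring letters, is left to the predicates of the sums; the list
    itself is then a product over the letters. *)
Fixpoint decs (x : seq nat) : seq (seq nat * seq nat) :=
  if x is k :: x' then
    [seq (p.1 :: q.1, p.2 :: q.2) | p <- max_pairs k, q <- decs x']
  else [:: ([::], [::])].

Arguments decs : simpl never.
Arguments max_pairs : simpl never.

Lemma max_pairs_uniq k : uniq (max_pairs k).
Proof. exact: filter_uniq. Qed.

Lemma mem_max_pairs k i j :
  ((i, j) \in max_pairs k) = [&& i < 3, j < 3 & maxn i j == k].
Proof.
rewrite mem_filter andbC andbA; congr (_ && _).
apply/allpairsP/andP => [[[a b] [ia ib [-> ->]]]|[i3 j3]].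
  by move: ia ib; rewrite !mem_iota.
by exists (i, j); rewrite !mem_iota.
Qed.

Lemma max_pairs_big k : 2 < k -> max_pairs k = [::].
Proof. by case: k => [|[|[|k]]]. Qed.

Lemma decs_uniq x : uniq (decs x).
Proof.
elim: x => //= k x IH; apply: allpairs_uniq => //; first exact: max_pairs_uniq.
by move=> [[a b] [c d]] [[a' b'] [c' d']] _ _ /= [-> -> -> ->].
Qed.

Lemma mem_decs x a b : ((a, b) \in decs x) =
  [&& all (gtn 3) a, all (gtn 3) b, size a == size b
    & [seq maxn p.1 p.2 | p <- zip a b] == x].
Proof.
elim: x a b => [|k x IH] a b /=.
  rewrite inE; case: a => [|i a]; case: b => [|j b] //=.
  - by rewrite andbF.
  - by rewrite !andbF.
  - by rewrite !andbF.
apply/idP/idP => [/allpairsP[[[i j] [c d]] /= [ij cd [-> ->]]]|].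
  move: ij cd; rewrite mem_max_pairs IH /= => /and3P[-> -> /eqP ->].
  by move=> /and4P[-> -> /eqP -> /eqP ->]; rewrite !eqxx.
case: a b => [|i a] [|j b] //=; try by rewrite !andbF.
move=> /and4P[/andP[i3 a3] /andP[j3 b3] /eqP[sab] /eqP[ijk abx]].
apply/allpairsP; exists ((i, j), (a, b)); split=> //=; first
  by rewrite mem_max_pairs i3 j3 ijk /=.
by rewrite IH a3 b3 sab abx !eqxx.
Qed.

(** A 2 in the maximum is a 2 in one of the words; the letter before it there is nonzero, hence so
    is the maximum of the preceding letters. *)
Lemma max_may_follow i j i' j' : may_follow i i' -> may_follow j j' ->
  may_follow (maxn i j) (maxn i' j').
Proof.
rewrite /may_follow => /implyP fi /implyP fj; apply/implyP => m2.
have : (i' == 2) || (j' == 2).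
  by move: m2; rewrite /maxn; case: ifP => _ ->; rewrite ?orbT.
by rewrite -lt0n leq_max !lt0n => /orP[/fi|/fj] ->; rewrite ?orbT.
Qed.

Lemma decs_valid x k i j a b : (a, b) \in decs x -> k = maxn i j ->
  path may_follow i a -> path may_follow j b -> path may_follow k x.
Proof.
rewrite mem_decs => /and4P[_ _ /eqP sab /eqP <-] ->.
elim: a b i j sab => [|i' a IH] [|j' b] i j //= [/IH {}IH].
move=> /andP[ii' /IH {}IH] /andP[jj' /IH {}IH].
by rewrite max_may_follow.
Qed.

(** * Sums over decompositions of a code *)

Section Sums.
Variable M : nmodType.
Local Open Scope ring_scope.

Lemma big_decs_cons (P : pred (seq nat * seq nat))
    (F : seq nat * seq nat -> M) k x :
  \sum_(p <- decs (k :: x) | P p) F p =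
  \sum_(p <- max_pairs k) \sum_(q <- decs x | P (p.1 :: q.1, p.2 :: q.2))
    F (p.1 :: q.1, p.2 :: q.2).
Proof.
rewrite [LHS]big_mkcond /= big_allpairs_dep /=.
by apply: eq_bigr => p _; rewrite [RHS]big_mkcond.
Qed.

Lemma big_decs_cat (P : pred (seq nat * seq nat))
    (F : seq nat * seq nat -> M) x y :
  \sum_(p <- decs (x ++ y) | P p) F p =
  \sum_(p <- decs x) \sum_(q <- decs y | P (p.1 ++ q.1, p.2 ++ q.2))
    F (p.1 ++ q.1, p.2 ++ q.2).
Proof.
elim: x P F => [|k x IH] P F.
  by rewrite cat0s /= big_seq1; apply: eq_big => -[].
rewrite cat_cons !big_decs_cons; apply: eq_bigr => p _; exact: IH.
Qed.

Lemma big_max_pairsA (G : nat -> nat -> nat -> M) k :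
  \sum_(p <- max_pairs k) \sum_(q <- max_pairs p.1) G q.1 q.2 p.2 =
  \sum_(p <- max_pairs k) \sum_(q <- max_pairs p.2) G p.1 q.1 q.2.
Proof.
have [k2|] := ltnP 2 k; first by rewrite max_pairs_big // !big_nil.
pose l3 := [seq (q.1, q.2, p.2) | p <- max_pairs k, q <- max_pairs p.1].
pose r3 := [seq (p.1, q.1, q.2) | p <- max_pairs k, q <- max_pairs p.2].
move=> k3; have lr : perm_eq l3 r3.
  (* Both lists consist of the triples of letters with maximum [k]; for each of the three values of
     [k] they are closed terms, and the permutation is checked by computation. *)
  by rewrite /l3 /r3; clear l3 r3; case: k k3 => [|[|[|k]]].
transitivity (\sum_(t <- l3) G t.1.1 t.1.2 t.2).
  by rewrite big_allpairs_dep.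
by rewrite (perm_big _ lr) big_allpairs_dep.
Qed.

(** Associativity of the maximum, letter by letter. [P] and [G] depend on whole words so that the
    induction can absorb the first letters into them. *)
Lemma big_decsA (P : seq nat -> seq nat -> seq nat -> bool)
    (G : seq nat -> seq nat -> seq nat -> M) x :
  \sum_(p <- decs x) \sum_(q <- decs p.1 | P q.1 q.2 p.2) G q.1 q.2 p.2 =
  \sum_(p <- decs x) \sum_(q <- decs p.2 | P p.1 q.1 q.2) G p.1 q.1 q.2.
Proof.
elim: x P G => [|k x IH] P G; first by rewrite !big_seq1 !big_cons !big_nil.
transitivity (\sum_(p <- max_pairs k) \sum_(q <- max_pairs p.1)
    \sum_(r <- decs x) \sum_(s <- decs r.1 |
      P (q.1 :: s.1) (q.2 :: s.2) (p.2 :: r.2))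
    G (q.1 :: s.1) (q.2 :: s.2) (p.2 :: r.2)).
  rewrite big_decs_cons; apply: eq_bigr => p _; rewrite exchange_big /=.
  by apply: eq_bigr => r _; rewrite big_decs_cons.
rewrite (big_max_pairsA (fun i j l => \sum_(r <- decs x) \sum_(s <- decs r.1 |
      P (i :: s.1) (j :: s.2) (l :: r.2)) G (i :: s.1) (j :: s.2) (l :: r.2))).
rewrite [RHS]big_decs_cons; apply: eq_bigr => p _.
transitivity (\sum_(q <- max_pairs p.2) \sum_(r <- decs x)
    \sum_(s <- decs r.2 | P (p.1 :: r.1) (q.1 :: s.1) (q.2 :: s.2))
    G (p.1 :: r.1) (q.1 :: s.1) (q.2 :: s.2)).
  apply: eq_bigr => q _.
  exact: (IH (fun a b c => P (p.1 :: a) (q.1 :: b) (q.2 :: c))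
    (fun a b c => G (p.1 :: a) (q.1 :: b) (q.2 :: c))).
rewrite exchange_big /=; apply: eq_bigr => r _; by rewrite big_decs_cons.
Qed.

(* Deleting the zeros of c does not change its valid decompositions: both
   factors vanish there, and a zero of c is never followed by a 2. *)
Lemma big_decs_nonzeros (F : seq nat -> seq nat -> M) c k i j i' j' :
  path may_follow k c -> (k != 0%N -> (i = i') /\ (j = j')) ->
  \sum_(p <- decs c | path may_follow i p.1 && path may_follow j p.2)
    F (nonzeros p.1) (nonzeros p.2) =
  \sum_(p <- decs (nonzeros c) | path may_follow i' p.1 && path may_follow j' p.2)
    F (nonzeros p.1) (nonzeros p.2).
Proof.
elim: c F k i j i' j' => [|l c IH] F k i j i' j'; first
  by rewrite /= !big_cons !big_nil.
(* Here [k] precedes [c], while [i], [j] precede the two factors before the deletion and [i'], [j']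
   after it. A deleted zero resets [i] and [j] to 0 but leaves [i'] and [j'], so agreement can be
   required only for nonzero [k]. *)
move=> /= /andP[kl lc] ij; have [l0|l0] := eqVneq l 0%N.
  rewrite l0 in lc *; rewrite big_decs_cons big_seq1 /=.
  exact: (IH F 0%N 0%N 0%N i' j' lc).
rewrite !big_decs_cons; apply: eq_big_seq => -[a b].
rewrite mem_max_pairs => /and3P[a3 b3 /eqP abl] /=.
have l3 : (l < 3)%N by rewrite -abl gtn_max a3 b3.
(* After [k = 0] the letter [l], and with it every [v <= l], is not 2, so it may follow any
   letter. *)
have mfE u u' v : (k != 0%N -> u = u') -> (v <= l)%N ->
    may_follow u v = may_follow u' v.
  move=> kuu vl; have [k0|/kuu -> //] := eqVneq k 0%N.
  rewrite /may_follow; case: eqP => // v2; move: kl; rewrite k0 /may_follow.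
  by rewrite (_ : l = 2%N) //; apply/eqP; rewrite eqn_leq -ltnS l3 -v2.
rewrite (mfE i i' a) ?(mfE j j' b) -?abl ?leq_maxl ?leq_maxr //;
  try by move=> /ij[].
case: (may_follow i' a); last by rewrite !big_pred0.
case: (may_follow j' b); last by rewrite !big_pred0 // => p; rewrite andbF.
pose G u v := F (nonzeros (a :: u)) (nonzeros (b :: v)).

apply: (IH (fun u v => F (if a != 0%N then a :: u else u)
                         (if b != 0%N then b :: v else v)) _ _ _ _ _ lc).
by [].
Qed.

(** Symmetry of the maximum; it derives the right counit law from the left one. *)
Lemma big_decsC (P : seq nat -> seq nat -> bool) (F : seq nat -> seq nat -> M) x :
  \sum_(p <- decs x | P p.1 p.2) F p.1 p.2 =
  \sum_(p <- decs x | P p.2 p.1) F p.2 p.1.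
Proof.
elim: x P F => [|k x IH] P F; first by rewrite !big_cons !big_nil.
rewrite !big_decs_cons.
have swapped : perm_eq (max_pairs k) [seq (p.2, p.1) | p <- max_pairs k].
  have [k2|] := ltnP 2 k; first by rewrite max_pairs_big.
  by case: k => [|[|[|k]]].
rewrite (perm_big _ swapped) big_map /=; apply: eq_bigr => p _.
exact: (IH (fun a b => P (p.2 :: a) (p.1 :: b))
  (fun a b => F (p.2 :: a) (p.1 :: b))).
Qed.

Lemma big_valid_decsA (F : seq nat -> seq nat -> seq nat -> M) x :
  \sum_(p <- decs x | valid p.1 && valid p.2)
    \sum_(q <- decs (nonzeros p.1) | valid q.1 && valid q.2)
      F (nonzeros q.1) (nonzeros q.2) (nonzeros p.2) =
  \sum_(p <- decs x | valid p.1 && valid p.2)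
    \sum_(q <- decs (nonzeros p.2) | valid q.1 && valid q.2)
      F (nonzeros p.1) (nonzeros q.1) (nonzeros q.2).
Proof.
transitivity (\sum_(p <- decs x)
    \sum_(q <- decs p.1 | [&& valid q.1, valid q.2 & valid p.2])
      F (nonzeros q.1) (nonzeros q.2) (nonzeros p.2)).
  rewrite big_mkcond /=; apply: eq_bigr => p _.
  case: ifP => [/andP[v1 v2]|nv].
    rewrite -(big_decs_nonzeros (i := 0%N) (j := 0%N) (fun a b => F a b
      (nonzeros p.2)) v1) //.
    by apply: eq_bigl => q; rewrite v2 andbT.
  (* Requiring [p.1] to be valid loses nothing: a word with a decomposition into valid words is
     valid. *)
  rewrite big_seq_cond big1 // => -[a b] /= /and4P[ab va vb v2].
  by rewrite (decs_valid ab (erefl : 0%N = maxn 0 0) va vb) v2 in nv.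
rewrite (big_decsA (fun a b c => [&& valid a, valid b & valid c])
  (fun a b c => F (nonzeros a) (nonzeros b) (nonzeros c))).
rewrite [RHS]big_mkcond /=; apply: eq_bigr => p _.
case: ifP => [/andP[v1 v2]|nv].
  rewrite -(big_decs_nonzeros (i := 0%N) (j := 0%N) (fun a b => F (nonzeros p.1)
    a b) v2) //.
  by apply: eq_bigl => q; rewrite v1.
rewrite big_seq_cond big1 // => -[a b] /= /and4P[ab v1 va vb].
by rewrite (decs_valid ab (erefl : 0%N = maxn 0 0) va vb) v1 in nv.
Qed.

Lemma big_valid_decs_cat (F : seq nat -> seq nat -> M) x y : valid y ->
  \sum_(p <- decs (x ++ y) | valid p.1 && valid p.2)
    F (nonzeros p.1) (nonzeros p.2) =
  \sum_(p <- decs x | valid p.1 && valid p.2)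
    \sum_(q <- decs y | valid q.1 && valid q.2)
      F (nonzeros p.1 ++ nonzeros q.1) (nonzeros p.2 ++ nonzeros q.2).
Proof.
move=> vy; rewrite big_decs_cat [RHS]big_mkcond /=; apply: eq_bigr => p _.
(* The first letter of [y] is not 2, hence neither are those of [a] and [b], and the letter before
   them is immaterial. *)
have pathE a b i : (a, b) \in decs y ->
    path may_follow i a = valid a /\ path may_follow i b = valid b.
  rewrite mem_decs => /and4P[a3 b3 /eqP sab /eqP yE].
  case: a b sab a3 b3 yE => [|k a] [|l b] //= _ /andP[k3 _] /andP[l3 _] yE.
  have : may_follow 0 (maxn k l) by move: vy; rewrite -yE /= => /andP[].
  by case: k l k3 l3 {yE} => [|[|[|k]]] [|[|[|l]]].
have catE q : q \in decs y -> valid (p.1 ++ q.1) && valid (p.2 ++ q.2) =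
    (valid p.1 && valid p.2) && (valid q.1 && valid q.2).
  case: q => a b qy /=; rewrite !cat_path.
  by rewrite (pathE a b _ qy).1 (pathE a b _ qy).2 andbACA.
rewrite big_seq_cond; case: ifP => [v12|nv].
  rewrite [RHS]big_seq_cond; apply: eq_big => q; last by rewrite !filter_cat.
  by case: (boolP (q \in _)) => //= qy; rewrite catE // v12.
rewrite big1 // => q /andP[qy]; by rewrite catE // nv.
Qed.

(** If [p.1] consists of zeros, then [p.2] is all of [x]. The letter [j] before [p.2] is general for
    the sake of the induction. *)
Lemma big_valid_decs_counitl (F : seq nat -> M) x j :
  all (fun k => 0 < k < 3)%N x -> path may_follow j x ->
  \sum_(p <- decs x | path may_follow 0 p.1 && path may_follow j p.2)
    (if nonzeros p.1 == [::] then F (nonzeros p.2) else 0) = F x.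
Proof.
elim: x F j => [|k x IH] F j; first by rewrite /= !big_cons big_nil addr0.
move=> /= /andP[/andP[k0 k3] x3] /andP[jk kx]; rewrite big_decs_cons.
(* Only the pair with 0 on the left survives; any other left letter stays in [nonzeros p.1]. *)
rewrite (bigD1_seq (0%N, k)) ?max_pairs_uniq //=; last first.
  by rewrite mem_max_pairs k3 max0n eqxx.
rewrite [X in _ + X]big_seq_cond [X in _ + X]big1 ?addr0; last first.
  move=> [a b] /andP[/=]; rewrite mem_max_pairs => /and3P[_ _ /eqP abk] ab.
  apply: big1 => q _; have [a0|//] := eqVneq a 0%N.
  by move: ab; rewrite -abk a0 max0n eqxx.
rewrite jk -(IH (fun y => F (k :: y)) k x3 kx).
by apply: eq_big => q //= _; rewrite -lt0n k0.
Qed.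

End Sums.

(** A maximum equal to 1 is attained by a letter 1. As the letters 1 count blocks, this is the
    source of the filtration by length. *)
Lemma count_decs x a b : (a, b) \in decs x ->
  count_mem 1 x <= count_mem 1 a + count_mem 1 b.
Proof.
rewrite mem_decs => /and4P[_ _ /eqP sab /eqP <-].
elim: a b sab => [|i a IH] [|j b] //= [/IH {}IH].
rewrite addnACA leq_add // /maxn; case: ifP => _; first exact: leq_addl.
exact: leq_addr.
Qed.

(** * Words of positive integers as codes without zeros *)

Definition posS (n : nat) : posn := exist _ n.+1 isT.

(** By [stip_code_stip_of], this is the code of the standard partition whose successive block sizes
    are the letters of [w]. *)
Definition bits (w : seq posn) : seq nat :=
  flatten [seq 1 :: nseq (val n).-1 2 | n <- w].

(* The first component counts the 2's preceding the first 1. *)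
Fixpoint runs (x : seq nat) : nat * seq posn :=
  if x is k :: x' then
    if k == 2 then ((runs x').1.+1, (runs x').2)
    else (0, posS (runs x').1 :: (runs x').2)
  else (0, [::]).

(** Leading 2s are dropped and any letter but 2 opens a block; the map is meant for valid codes
    without zeros, where it inverts [bits]. *)
Definition unbits (x : seq nat) : seq posn := (runs x).2.

Lemma bits_cat u v : bits (u ++ v) = bits u ++ bits v.
Proof. by rewrite /bits map_cat flatten_cat. Qed.

Lemma bitsK : cancel bits unbits.
Proof.
have runs_nseq c x : runs (nseq c 2 ++ x) = (c + (runs x).1, (runs x).2).
  by elim: c => [|c IH] /=; [case: (runs x)|rewrite IH].
suff rb w : runs (bits w) = (0, w) by move=> w; rewrite /unbits rb.
elim: w => //= n w IH; rewrite /bits /= -/(bits w) runs_nseq IH /= addn0.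
by congr (_, _ :: _); apply: val_inj => /=; rewrite prednK // (valP n).
Qed.

Lemma unbitsK x : all (fun k => 0 < k < 3) x -> valid x -> bits (unbits x) = x.
Proof.
move=> x3 vx.
have runsE y : all (fun k => 0 < k < 3) y ->
    nseq (runs y).1 2 ++ bits (runs y).2 = y.
  elim: y => //= k y IH /andP[k3 /IH {}IH]; case: eqP => [-> /=|k2].
    by rewrite IH.
  have -> : k = 1 by move: k k3 k2 => [|[|[|k]]].
  by rewrite /bits /= -/(bits _) IH.
rewrite -[RHS]runsE //; case: x x3 vx => //= k x _ /andP[k2 _].
have kn2 : k != 2 by apply: contraL k2 => /eqP ->.
by rewrite /unbits /= (negPf kn2).
Qed.

Lemma bits_valid i w : path may_follow i (bits w).
Proof.
have path2 c x : path may_follow 1 (nseq c 2 ++ x) =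
    path may_follow (if c is 0 then 1 else 2) x.
  by case: c => //= c; elim: c.
elim: w i => //= n w IH i; rewrite /bits /= -/(bits w) path2; apply: IH.
Qed.

Lemma bits_bounds w : all (fun k => 0 < k < 3) (bits w).
Proof.
elim: w => //= n w IH; rewrite /bits /= -/(bits w) all_cat IH andbT.
by rewrite all_nseq orbT.
Qed.

Lemma count_bits w : count_mem 1 (bits w) = size w.
Proof.
elim: w => //= n w IH; rewrite /bits /= -/(bits w) count_cat IH.
by rewrite count_nseq.
Qed.

Lemma bits_inj : injective bits.
Proof. exact: can_inj bitsK. Qed.

(** A letter 2 is preceded by a nonzero letter, which survives the deletion. *)
Lemma valid_nonzeros a : valid a -> valid (nonzeros a).
Proof.
suff pathP i j x : (i != 0 -> j != 0) -> path may_follow i x ->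
  path may_follow j (nonzeros x) by apply: pathP.
elim: x i j => //= k x IH i j ij /andP[ik kx]; have [k0|k0] := eqVneq k 0.
  by apply: (IH k) => //; rewrite k0.
rewrite /= (IH k) // andbT; apply/implyP => /(implyP ik); exact: ij.
Qed.

Lemma nonzeros_bits a : all (gtn 3) a -> valid a -> bits (unbits (nonzeros a)) =
  nonzeros a.
Proof.
move=> a3 va; apply: unbitsK (valid_nonzeros va).
apply/allP => k; rewrite mem_filter lt0n => /andP[-> ka].
exact: (allP a3).
Qed.

Definition word_of_code (x : seq nat) : word := FMonom (unbits x).

(** A list with repetitions: different decompositions may leave the same pair of words, and the
    coproduct counts them with multiplicity. *)
Definition word_splits (w : word) : seq (word * word) :=
  [seq (word_of_code (nonzeros p.1), word_of_code (nonzeros p.2)) |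
    p <- decs (bits w) & valid p.1 && valid p.2].

Lemma big_word_splits (M : nmodType) (F : word * word -> M) w :
  (\sum_(p <- word_splits w) F p = \sum_(p <- decs (bits w) | valid p.1 && valid p.2)
     F (word_of_code (nonzeros p.1), word_of_code (nonzeros p.2)))%R.
Proof. by rewrite /word_splits big_map big_filter. Qed.

Lemma bits_word_of_code x a b : (a, b) \in decs x -> valid a -> valid b ->
  bits (word_of_code (nonzeros a)) = nonzeros a /\ bits (word_of_code (nonzeros
    b)) = nonzeros b.
Proof.
by rewrite mem_decs => /and4P[a3 b3 _ _] va vb; split; apply: nonzeros_bits.
Qed.

Lemma word_of_code_bits (w : word) : word_of_code (bits w) = w.
Proof. by rewrite /word_of_code bitsK fmK. Qed.

Lemma word_splits_coassoc (M : nmodType) (F : word -> word -> word -> M) w :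
  (\sum_(p <- word_splits w) \sum_(q <- word_splits p.1) F q.1 q.2 p.2 =
   \sum_(p <- word_splits w) \sum_(q <- word_splits p.2) F p.1 q.1 q.2)%R.
Proof.
rewrite !big_word_splits.
have := big_valid_decsA (fun a b c => F (word_of_code a) (word_of_code b)
  (word_of_code c)) (bits w).
move=> E; etransitivity; [|etransitivity; [exact: E|]];
  rewrite big_seq_cond [RHS]big_seq_cond; apply: eq_bigr => -[a b];
  move=> /andP[ab /andP[va vb]]; rewrite big_word_splits /=;
  have [Ea Eb] := bits_word_of_code ab va vb; by rewrite ?Ea ?Eb.
Qed.

Lemma word_splits_mul (M : nmodType) (F : word -> word -> M) (u v : word) :
  (\sum_(p <- word_splits (FMonom (u ++ v))) F p.1 p.2 =
   \sum_(p <- word_splits u) \sum_(q <- word_splits v)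
     F (FMonom (p.1 ++ q.1)) (FMonom (p.2 ++ q.2)))%R.
Proof.
rewrite !big_word_splits /= bits_cat.
rewrite (big_valid_decs_cat (fun a b => F (word_of_code a) (word_of_code b)))
  ?bits_valid //.
rewrite big_seq_cond [RHS]big_seq_cond; apply: eq_bigr => -[a b].
move=> /andP[ab /andP[va vb]]; rewrite big_word_splits /=.
rewrite big_seq_cond [RHS]big_seq_cond; apply: eq_bigr => -[c d].
move=> /andP[cd /andP[vc vd]] /=.
have [aE bE] := bits_word_of_code ab va vb;
  have [cE dE] := bits_word_of_code cd vc vd.
rewrite -{1}aE -{1}bE -{1}cE -{1}dE -!bits_cat.
by congr F; rewrite /word_of_code bitsK.
Qed.

Lemma word_splits_nil : word_splits (FMonom [::]) = [:: (FMonom [::], FMonom [::])].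
Proof. by []. Qed.

Lemma word_of_code_eq_nil x a b : (a, b) \in decs x -> valid a -> valid b ->
  (word_of_code (nonzeros a) == FMonom [::]) = (nonzeros a == [::]).
Proof.
move=> ab va vb; have [aE _] := bits_word_of_code ab va vb.
by apply/eqP/eqP => [E|->]; rewrite // -aE E.
Qed.

Lemma word_splits_counitl (M : nmodType) (F : word -> M) w :
  (\sum_(p <- word_splits w) (if p.1 == FMonom [::] then F p.2 else 0) = F w)%R.
Proof.
have := big_valid_decs_counitl (F \o word_of_code) (bits_bounds w) (bits_valid 0 w).
rewrite /= word_of_code_bits => <-;
  rewrite big_word_splits big_seq_cond [RHS]big_seq_cond; apply: eq_bigr => -[a b].
by move=> /andP[ab /andP[va vb]] /=; rewrite (word_of_code_eq_nil ab va vb).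
Qed.

Lemma big_word_splitsC (M : nmodType) (F : word -> word -> M) w :
  (\sum_(p <- word_splits w) F p.1 p.2 = \sum_(p <- word_splits w) F p.2 p.1)%R.
Proof.
rewrite !big_word_splits.
rewrite (big_decsC (fun a b => valid a && valid b)
  (fun a b => F (word_of_code (nonzeros a)) (word_of_code (nonzeros b)))).
by apply: eq_bigl => p; rewrite andbC.
Qed.

(** The length of a word is the number of 1s in its code, which the deletion of zeros does not
    change. *)
Lemma word_splits_size w u v : (u, v) \in word_splits w -> size w <= size u + size v.
Proof.
move=> /mapP[[a b] /=]; rewrite mem_filter => /andP[/andP[va vb] ab] [-> ->].
rewrite -!count_bits; have [-> ->] := bits_word_of_code ab va vb.
by rewrite !count_filter; have := count_decs ab;
  rewrite !(eq_count (a1 := predI _ _) (a2 := pred1 1)) // => k /=;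
  case: eqP => // ->.
Qed.

(** * Codes of interval partitions *)

Local Open Scope fset_scope.
Local Open Scope nat_scope.

Section Codes.
Implicit Types (A B C E F G : {fset nat}) (I J K : {fset {fset nat}}).

(** Blocks being intervals, a partition is determined by its ground set and these links between
    consecutive integers ([eq_ip]). All comparisons of partitions go through these two data. *)
Definition linked I i : bool := has (fun E => (i \in E) && (i.+1 \in E)) I.

Lemma linkedP I i :
  reflect (exists2 E, E \in I & i \in E /\ i.+1 \in E) (linked I i).
Proof.
by apply: (iffP hasP) => [[E EI /andP[]]|[E EI [iE jE]]];
  exists E => //; apply/andP.
Qed.

(* Letter [i] describes the integer [i.+1]: 0 outside of the ground set, 2 in
   the block of [i], and 1 at the start of a block. *)
Definition letter I i : nat := (i.+1 \in fcover I) + linked I i.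

Definition code n I : seq nat := mkseq (letter I) n.

Lemma linked_cover I i : linked I i -> i \in fcover I /\ i.+1 \in fcover I.
Proof. by case/linkedP=> E EI [iE jE]; split; apply/in_fcover; exists E. Qed.

Lemma letter_lt3 I i : letter I i < 3.
Proof. by rewrite /letter; case: (_ \in _); case: linked. Qed.

Lemma letter_eq0 I i : (letter I i == 0) = (i.+1 \notin fcover I).
Proof.
rewrite /letter; case: (boolP (_ \in _)) => // /negPf niI; rewrite add0n.
by case: (boolP (linked I i)) => // /linked_cover[_]; rewrite niI.
Qed.

Lemma letter_eq2 I i : (letter I i == 2) = linked I i.
Proof.
rewrite /letter; case: (boolP (linked I i)) => [/linked_cover[_ ->]//|_].
by case: (_ \in _).
Qed.

(** A link into [i.+1] forces [i.+1] into the ground set, so the two bits of a letter form a chain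
    and the maximum is their disjunction; the finitely many cases are checked. *)
Lemma letter_max I J K i : (letter K i == maxn (letter I i) (letter J i)) =
  ((i.+1 \in fcover K) == (i.+1 \in fcover I) || (i.+1 \in fcover J)) &&
  (linked K i == linked I i || linked J i).
Proof.
have lc L : linked L i ==> (i.+1 \in fcover L).
  by apply/implyP; case/linked_cover.
rewrite /letter; move: (lc I) (lc J) (lc K).
by case: (linked I i); case: (linked J i); case: (linked K i);
   case: (_ \in fcover I); case: (_ \in fcover J); case: (_ \in fcover K).
Qed.

Lemma block_unique A I E F x : is_ip A I -> E \in I -> F \in I ->
  x \in E -> x \in F -> E = F.
Proof.
case/is_ipP=> _ dI _ EI FI xE xF; apply/eqP; apply: contraTT xF => nEF.
by move/fdisjointP: (dI _ _ EI FI nEF); apply.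
Qed.

(** Walking through the interval [E] from its left end, each step is a link of [I], hence of [J],
    and stays in the block of [J] containing that end. *)
Lemma sub_block A B I J E : is_ip A I -> is_ip B J -> A `<=` B ->
  (forall i, linked I i -> linked J i) -> E \in I ->
  exists2 F, F \in J & E `<=` F.
Proof.
move=> ipI ipJ /fsubsetP AB IJ EI; case/is_ipP: (ipI) => cI _ /(_ _ EI).
case/is_intervalP=> a [b [ab eE]].
have Ex x : (x \in E) = (a <= x <= b) by rewrite eE Defs.in_itv.
have : a \in B.
  by apply: AB; rewrite -cI; apply/in_fcover; exists E; rewrite // Ex leqnn.
case/is_ipP: (ipJ) => cJ _ _; rewrite -cJ => /in_fcover[F FJ aF].
exists F => //; apply/fsubsetP => x; rewrite Ex => /andP[ax].
rewrite -(subnKC ax); elim: (x - a) => [|k IH]; first by rewrite addn0.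
rewrite addnS => kb; have /IJ/linkedP[F' F'J [kF' k1F']] : linked I (a + k).
  apply/linkedP; exists E => //; rewrite !Ex (ltnW kb) kb leq_addr.
  by rewrite (leq_trans (leq_addr k a)).
by rewrite (block_unique ipJ FJ F'J (IH (ltnW kb)) kF').
Qed.

Lemma block_neq0 A I E : is_ip A I -> E \in I -> exists x, x \in E.
Proof.
case/is_ipP=> _ _ iI /iI/is_intervalP[a [b [ab ->]]].
by exists a; rewrite Defs.in_itv leqnn.
Qed.

Definition sub_ip n I := is_ip (fcover I) I && (fcover I `<=` seg n).

Lemma linked_sub n I i : sub_ip n I -> linked I i -> 0 < i < n.
Proof.
case/andP=> _ /fsubsetP In /linked_cover[/In + /In].
by rewrite !in_seg => /andP[-> _].
Qed.

(** Applying [sub_block] both ways puts [E] inside [F] and [F] inside a block [E'] of the first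
    partition; [E'] meets [E], hence equals it. *)
Lemma eq_ip A B I J : is_ip A I -> is_ip B J -> A = B ->
  linked I =1 linked J -> I = J.
Proof.
suff sub A' B' I' J' : is_ip A' I' -> is_ip B' J' -> A' = B' ->
    linked I' =1 linked J' -> I' `<=` J'.
  by move=> ipI ipJ AB IJ; apply/eqP; rewrite eqEfsubset (sub A B) // (sub B A).
move=> {A B I J} ipI ipJ AB IJ; apply/fsubsetP => E EI.
have [||F FJ EF] := sub_block ipI ipJ _ _ EI; first by rewrite AB.
  by move=> i; rewrite IJ.
have [||E' E'I FE'] := sub_block ipJ ipI _ _ FJ; first by rewrite AB.
  by move=> i; rewrite IJ.
have [x xE] := block_neq0 ipI EI.
have xE' : x \in E' by apply: (fsubsetP FE'); apply: (fsubsetP EF).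
have EE' := block_unique ipI EI E'I xE xE'.
suff -> : E = F by [].
by apply/eqP; rewrite eqEfsubset EF EE'.
Qed.

Lemma code_max n I J K : sub_ip n I -> sub_ip n J -> sub_ip n K ->
  [seq maxn p.1 p.2 | p <- zip (code n I) (code n J)] = code n K <->
  fcover K = fcover I `|` fcover J /\
  linked K =1 (fun i => linked I i || linked J i).
Proof.
move=> sI sJ sK; set l := map _ _.
have sl : size l = n by rewrite size_map size_zip !size_mkseq minnn.
have nl i : i < n -> nth 0 l i = maxn (letter I i) (letter J i).
  move=> ni; rewrite (nth_map (0, 0)) ?size_zip ?size_mkseq ?minnn //.
  by rewrite nth_zip ?size_mkseq //= !nth_mkseq.
have seg_sub L x : sub_ip n L -> x \in fcover L -> 0 < x <= n.
  by case/andP=> _ /fsubsetP Ln /Ln; rewrite in_seg.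
split=> [lK|[cK lK]].
  have letterE i : i < n -> letter K i == maxn (letter I i) (letter J i).
    by move=> ni; rewrite -nl // lK nth_mkseq.
  split.
    (* Codes see only the integers from 1 to [n]; 0 and the integers above [n] lie in none of the
       ground sets. *)
    apply/fsetP => -[|x]; rewrite inE.
      have out L : sub_ip n L -> (0 \in fcover L) = false.
        by move=> sL; apply/negP => /(seg_sub _ _ sL).
      by rewrite !out.
    have [xn|nx] := ltnP x n.
      by move: (letterE x xn); rewrite letter_max => /andP[/eqP].
    have out L : sub_ip n L -> (x.+1 \in fcover L) = false.
      by move=> sL; apply/negP => /(seg_sub _ _ sL); rewrite /= ltnNge nx.
    by rewrite !out.
  move=> i; have [xn|nx] := ltnP i n.
    by move: (letterE i xn); rewrite letter_max => /andP[_ /eqP].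
  have out L : sub_ip n L -> linked L i = false.
    by move=> sL; apply/negP => /(linked_sub sL); rewrite [i < n]ltnNge nx andbF.
  by rewrite !out.
apply: (@eq_from_nth _ 0); first by rewrite sl size_mkseq.
move=> i; rewrite sl => ni; rewrite nl // nth_mkseq //; apply/esym/eqP.
by rewrite letter_max cK inE lK !eqxx.
Qed.

Lemma code_inj n I J : sub_ip n I -> sub_ip n J -> code n I = code n J -> I = J.
Proof.
move=> sI sJ IJ; have [|cJ lJ] := (code_max sI sI sJ).1.
  rewrite -IJ; apply: (@eq_from_nth _ 0).
    by rewrite size_map size_zip !size_mkseq minnn.
  move=> i; rewrite size_map size_zip !size_mkseq minnn => ni.
  rewrite (nth_map (0, 0)) ?size_zip ?size_mkseq ?minnn //.
  by rewrite nth_zip ?size_mkseq //= maxnn.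
case/andP: sI => ipI _; case/andP: sJ => ipJ _.
by apply: (eq_ip ipI ipJ) => [|i]; rewrite ?cJ ?fsetUid // lJ orbb.
Qed.

(** Overlapping blocks of [I] and [J] lie in the same block of [K]; conversely the blocks inside one
    block of [K] are connected by overlaps, since any two consecutive integers of it share a block
    of [I] or [J]. *)
Lemma glue_linked A B C I J K : is_ip A I -> is_ip B J -> is_ip C K ->
  C = A `|` B -> (linked K =1 fun i => linked I i || linked J i) ->
  glue I J = K.
Proof.
move=> ipI ipJ ipK CAB lK; set U := I `|` J.
have inC x : (x \in C) = [exists E : U, x \in val E].
  case/is_ipP: ipI => cI _ _; case/is_ipP: ipJ => cJ _ _.
  rewrite CAB inE -cI -cJ; apply/orP/existsP.
    case=> /in_fcover[E EIJ xE].
      by have EU : E \in U by [rewrite inE EIJ]; exists [` EU].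
    by have EU : E \in U by [rewrite inE EIJ orbT]; exists [` EU].
  case=> -[/= E EU] xE; move: EU; rewrite inE.
  by case/orP=> EIJ; [left|right]; apply/in_fcover; exists E.
have subU (E : U) : exists2 G, G \in K & val E `<=` G.
  case: E => /= E; rewrite inE => /orP[EI|EJ].
    by apply: sub_block ipI ipK _ _ EI; rewrite ?CAB ?fsubsetUl // => i;
      rewrite lK => ->.
  apply: sub_block ipJ ipK _ _ EJ; rewrite ?CAB ?fsubsetUr // => i.
  by rewrite lK orbC => ->.
have nzU (E : U) : exists x, x \in val E.
  case: E => /= E; rewrite inE => /orP[EI|EJ].
    exact: block_neq0 ipI EI.
  exact: block_neq0 ipJ EJ.
have overlapP (E F : U) x : x \in val E -> x \in val F -> overlap E F.
  by move=> xE xF; apply/fset0Pn; exists x; rewrite inE xE.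
have inG (E : U) G x : G \in K -> x \in val E -> x \in G -> val E `<=` G.
  move=> GK xE xG; have [G' G'K EG'] := subU E.
  by rewrite (block_unique ipK GK G'K xG (fsubsetP EG' _ xE)).
have connG (E F : U) G : G \in K -> connect (@overlap U) E F ->
    val E `<=` G -> val F `<=` G.
  move=> GK /connectP[p + ->]; elim: p E => //= E' p IH E /andP[EE' /IH {}IH] EG.
  apply: IH; case/fset0Pn: EE' => x; rewrite inE => /andP[xE xE'].
  exact: inG GK xE' (fsubsetP EG _ xE).
have Gconn (E F : U) G : G \in K -> val E `<=` G -> val F `<=` G ->
    connect (@overlap U) E F.
  move=> GK; case/is_ipP: (ipK) => cK _ /(_ _ GK)/is_intervalP[a [b [ab eG]]].
  have Gx x : (x \in G) = (a <= x <= b) by rewrite eG Defs.in_itv.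
  have : a \in C by rewrite -cK; apply/in_fcover; exists G; rewrite // Gx leqnn.
  rewrite inC => /existsP[E0 aE0].
  (* Induction on the distance from the left end [a] of [G]: [a + k] and its successor lie in a
     common [E2], which is reached by induction and meets [E1]. *)
  have E0conn (E1 : U) : val E1 `<=` G -> connect (@overlap U) E0 E1.
    have [x xE1] := nzU E1 => /fsubsetP/(_ _ xE1); rewrite Gx => /andP[ax].
    move: xE1; rewrite -(subnKC ax); elim: (x - a) E1 => [|k IH] E1.
      by rewrite addn0 => aE1 _; apply: connect1; apply: overlapP aE1.
    rewrite addnS => k1E1 kb; have : linked K (a + k).
      apply/linkedP; exists G => //; rewrite !Gx (ltnW kb) kb leq_addr.
      by rewrite (leq_trans (leq_addr k a)).
    rewrite lK => lk; have [E2 [kE2 k1E2]] :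
        exists E2 : U, a + k \in val E2 /\ (a + k).+1 \in val E2.
      case/orP: lk => /linkedP[E2 E2IJ E2k].
        by have EU : E2 \in U by [rewrite inE E2IJ]; exists [` EU].
      by have EU : E2 \in U by [rewrite inE E2IJ orbT]; exists [` EU].
    apply: connect_trans (IH _ kE2 (ltnW kb)) _.
    by apply: connect1; apply: overlapP k1E1.
  move=> /E0conn E0E /E0conn E0F.
  have /equivalence_relP[_ rt] := @glue_equiv U.
  by rewrite -(rt _ _ E0E).
have classE (E : U) G : G \in K -> val E `<=` G ->
    \bigcup_(F | connect (@overlap U) E F) val F = G.
  move=> GK EG; apply/fsetP => x; apply/bigfcupP/idP => [[F /andP[_ EF] xF]|xG].
    exact: fsubsetP (connG _ _ _ GK EF EG) _ xF.
  have : x \in C.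
    by case/is_ipP: ipK => <- _ _; apply/in_fcover; exists G.
  rewrite inC => /existsP[F xF]; exists F => //.
  by rewrite mem_index_enum (Gconn _ _ _ GK EG) // (inG _ _ _ GK xF xG).
apply/fsetP => G; apply/imfsetP/idP => [[E _ ->]|GK].
  by have [G' G'K EG'] := subU E; rewrite (classE _ _ G'K EG').
have [x xG] := block_neq0 ipK GK.
have : x \in C by case/is_ipP: ipK => <- _ _; apply/in_fcover; exists G.
rewrite inC => /existsP[F xF]; exists F => //.
by rewrite (classE _ _ GK (inG _ _ _ GK xF xG)).
Qed.

End Codes.

(** * Concatenation, and realization of every valid code *)

Section Existence.
Implicit Types (A : {fset nat}) (I J : {fset {fset nat}}).

Definition shift_ip m J : {fset {fset nat}} := [fset shift m E | E in J].

Lemma fcover_shift m J x :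
  (x \in fcover (shift_ip m J)) = (m <= x) && (x - m \in fcover J).
Proof.
apply/in_fcover/andP => [[E /imfsetP[/= F FJ ->] /imfsetP[/= y yF ->]]|[mx xJ]].
  by rewrite leq_addl addnK; split=> //; apply/in_fcover; exists F.
case/in_fcover: xJ => F FJ xF; exists (shift m F); first exact: in_imfset.
by apply/imfsetP; exists (x - m) => //=; rewrite subnK.
Qed.

Lemma linked_shift m J i : linked (shift_ip m J) (i + m) = linked J i.
Proof.
apply/linkedP/linkedP => [[E /imfsetP[/= F FJ ->] [/imfsetP[/= y yF]]]|[F FJ
  [iF jF]]].
  move=> /addIn -> /imfsetP[/= z zF]; rewrite -addSn => /addIn zE.
  by exists F => //; rewrite zE.
exists (shift m F); first exact: in_imfset.
by split; apply/imfsetP; [exists i|exists i.+1].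
Qed.

Lemma linked_shift_lt m J i : i < m -> linked (shift_ip m J) i = false.
Proof.
move=> im; apply/negP => /linked_cover[].
by rewrite fcover_shift leqNgt im.
Qed.

Lemma fcoverU I J x : (x \in fcover (I `|` J)) = (x \in fcover I) || (x \in fcover J).
Proof.
apply/in_fcover/orP => [[E]|[] /in_fcover[E EIJ xE]].
- by rewrite inE => /orP[] EIJ xE; [left|right]; apply/in_fcover; exists E.
- by exists E => //; rewrite inE EIJ.
- by exists E => //; rewrite inE EIJ orbT.
Qed.

Lemma linkedU I J i : linked (I `|` J) i = linked I i || linked J i.
Proof.
apply/linkedP/orP => [[E]|[] /linkedP[E EIJ iE]].
- by rewrite inE => /orP[] EIJ iE; [left|right]; apply/linkedP; exists E.
- by exists E => //; rewrite inE EIJ.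
- by exists E => //; rewrite inE EIJ orbT.
Qed.

Lemma mem_shift m (A : {fset nat}) x : (x \in shift m A) = (m <= x) && (x - m \in A).
Proof.
apply/imfsetP/andP => [[y /= yA ->]|[mx xA]]; first by rewrite leq_addl addnK.
by exists (x - m); rewrite //= subnK.
Qed.

(** [I] has no integer above [m] and the shifted [J] none up to [m], so no link crosses the seam. *)
Lemma sub_ip_shift m n I J : sub_ip m I -> sub_ip n J ->
  sub_ip (m + n) (I `|` shift_ip m J) /\
  code (m + n) (I `|` shift_ip m J) = code m I ++ code n J.
Proof.
move=> /andP[ipI /fsubsetP Im] /andP[ipJ /fsubsetP Jn].
have cE : fcover (I `|` shift_ip m J) = fcover I `|` shift m (fcover J).
  by apply/fsetP => x; rewrite inE fcoverU fcover_shift mem_shift.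
split.
  apply/andP; split; rewrite cE.
    apply: is_ipU => //.
      apply/fdisjointP => x /Im; rewrite in_seg mem_shift => /andP[_ xm].
      apply/negP => /andP[mx /Jn].
      have -> : x = m by apply/eqP; rewrite eqn_leq xm.
      by rewrite subnn in_seg.
    apply: is_ip_imfset => // [x y _ _ /addIn //|E EJ].
    case/is_ipP: ipJ => _ _ /(_ E EJ)/is_intervalP[a [b [ab ->]]].
    apply/is_intervalP; exists (a + m), (b + m).
    by split; [rewrite leq_add2r|exact: shift_itv].
  apply/fsubsetP => x; rewrite inE mem_shift => /orP[/Im|/andP[mx /Jn]].
    rewrite !in_seg => /andP[-> xm]; apply: leq_trans xm _; exact: leq_addr.
  rewrite !in_seg subn_gt0 leq_subLR => /andP[mx' ->].
  by rewrite (leq_trans _ mx').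
rewrite /code /mkseq iotaD map_cat add0n; congr (_ ++ _).
  apply/eq_in_map => i; rewrite mem_iota /= add0n => im.
  rewrite /letter fcoverU fcover_shift linkedU linked_shift_lt // orbF.
  suff -> : (i.+1 - m \in fcover J) = false by rewrite andbF orbF.
  by apply/negP => /Jn; rewrite in_seg subn_gt0 ltnS leqNgt im.
rewrite -[X in iota X _]addn0 iotaDl -map_comp; apply: eq_map => i /=.
rewrite /letter fcoverU linkedU -addnS fcover_shift leq_addr addKn.
rewrite [m + i]addnC linked_shift.
have nI k : m < k -> (k \in fcover I) = false.
  by move=> mk; apply/negP => /Im; rewrite in_seg [k <= m]leqNgt mk andbF.
have -> : (m + i.+1 \in fcover I) = false by apply: nI; rewrite addnS ltnS leq_addr.
suff -> : linked I (i + m) = false by [].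
by apply/negP => /linked_cover[_]; rewrite nI // ltnS leq_addl.
Qed.

Lemma fcover0 : fcover fset0 = fset0 :> {fset nat}.
Proof.
by apply/fsetP => x; apply/in_fcover; rewrite inE => -[E]; rewrite inE.
Qed.

Lemma linked0 i : linked fset0 i = false.
Proof. by apply/linkedP => -[E]; rewrite inE. Qed.

Lemma sub_ip0 n : sub_ip n fset0.
Proof.
by rewrite /sub_ip fcover0 fsub0set andbT; apply/is_ipP;
  split=> [|E|E]; rewrite ?fcover0 // inE.
Qed.

Lemma fcover1 (A : {fset nat}) : fcover [fset A] = A.
Proof.
apply/fsetP => x; apply/in_fcover/idP => [[E]|xA].
  by rewrite inE => /eqP ->.
by exists A; rewrite ?inE.
Qed.

Lemma sub_ip_block (n : posn) : sub_ip (val n) [fset seg (val n)].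
Proof.
have := block_subproof n; rewrite /is_std /sub_ip fcover1 card_seg => ->.
exact: fsubset_refl.
Qed.

Lemma code_block (n : posn) :
  code (val n) [fset seg (val n)] = 1 :: nseq (val n).-1 2.
Proof.
case: n => -[//|n] /= _; apply: (@eq_from_nth _ 0).
  by rewrite size_mkseq /= size_nseq.
move=> i; rewrite size_mkseq => ni; rewrite nth_mkseq // /letter fcover1 in_seg ni /=.
have -> : linked [fset seg n.+1] i = (0 < i).
  apply/linkedP/idP => [[E /fset1P -> []]|i0]; first by rewrite in_seg => /andP[].
  by exists (seg n.+1); rewrite ?fset11 // !in_seg i0 ni (ltnW ni).
by case: i ni => //= i ni; rewrite nth_nseq -ltnS ni.
Qed.

Lemma exists_code a : all (gtn 3) a -> valid a ->
  exists2 I, sub_ip (size a) I & code (size a) I = a.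
Proof.
(* The induction is on a bound for the length, since a whole block may be removed at once. *)
move: {2}(size a) (leqnn (size a)) => n; elim: n a => [|n IH] [|k a] //=.
- by move=> _ _ _; exists fset0; first exact: sub_ip0.
- by move=> _ _ _; exists fset0; first exact: sub_ip0.
rewrite ltnS => an /andP[k3 a3] /andP[k2 va].
have [k0|k0] := eqVneq k 0.
  rewrite k0 in va *; have [J sJ cJ] := IH a an a3 va.
  have [sIJ cIJ] := sub_ip_shift (sub_ip0 1) sJ.
  exists (fset0 `|` shift_ip 1 J) => //; rewrite cIJ cJ /code /= /letter.
  by rewrite fcover0 inE linked0.
have k1 : k = 1 by move: k k3 k2 k0 {va} => [|[|[|k]]].
rewrite {k k3 k2 k0}k1 in va *.
(* The first 1 and the [c] letters 2 after it form a block of size [c.+1]; the rest [b] is valid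
   because it no longer starts with a 2. *)
have [c [b [aE vb]]] : exists c b, a = nseq c 2 ++ b /\ valid b.
  have : exists j, path may_follow j a by exists 1.
  elim: (a) => [|k a' IHa] [j /=]; first by exists 0, [::].
  move=> /andP[jk va']; have [k2|k2] := eqVneq k 2.
    by have [c [b [aE vb]]] := IHa (ex_intro _ k va'); exists c.+1, b; split;
      rewrite // k2 aE.
  by exists 0, (k :: a'); split; rewrite //= va' /may_follow (negPf k2).
have bn : size b <= n.
  by apply: leq_trans an; rewrite aE size_cat size_nseq leq_addl.
have b3 : all (gtn 3) b by move: a3; rewrite aE all_cat => /andP[].
have [J sJ cJ] := IH b bn b3 vb.
pose m : posn := posS c.
have [sIJ cIJ] := sub_ip_shift (sub_ip_block m) sJ.
exists ([fset seg (val m)] `|` shift_ip (val m) J).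
  by move: sIJ; rewrite aE size_cat size_nseq -addSn.
by move: cIJ; rewrite code_block cJ /= aE size_cat size_nseq -addSn.
Qed.

End Existence.

(** * Standardization deletes zeros, and gluing is the maximum *)

Section Standardization.
Implicit Types (g s t : stip).

Definition stip_code g : seq nat := code #|` fcover g| g.

Lemma fcover_stip g : fcover g = seg #|` fcover g|.
Proof. by case/is_ipP: (stip_valP g). Qed.

Lemma mem_fcover_stip g x : (x \in fcover g) = (0 < x <= #|` fcover g|).
Proof. by rewrite {1}fcover_stip in_seg. Qed.

Lemma stip_sub_ip g : sub_ip #|` fcover g| g.
Proof.
apply/andP; rewrite -fcover_stip fsubset_refl; split=> //.
by rewrite [X in is_ip X]fcover_stip; apply: stip_valP.
Qed.

Lemma size_stip_code g : size (stip_code g) = #|` fcover g|.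
Proof. by rewrite size_mkseq. Qed.

Lemma stip_code_inj : injective stip_code.
Proof.
move=> s t st; apply: val_inj; have cst : #|` fcover s| = #|` fcover t|.
  by rewrite -!size_stip_code st.
apply: (code_inj (stip_sub_ip s)); first by rewrite cst; apply: stip_sub_ip.
by move: st; rewrite /stip_code -cst.
Qed.

Lemma stip_code_bounds g : all (fun k => 0 < k < 3) (stip_code g).
Proof.
apply/allP => k /mapP[i]; rewrite mem_iota add0n => /= ig ->.
by rewrite letter_lt3 andbT lt0n letter_eq0 negbK mem_fcover_stip.
Qed.

Lemma code_lt3 n I : all (gtn 3) (code n I).
Proof. by apply/allP => k /mapP[i _ ->]; apply: letter_lt3. Qed.

Lemma code_valid n I : sub_ip n I -> valid (code n I).
Proof.
move=> sI; apply/(pathP 0) => i; rewrite size_mkseq => ni.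
rewrite nth_mkseq // /may_follow letter_eq2; apply/implyP => /[dup] /(linked_sub sI).
case: i ni => // i ni _ /linked_cover[iI _].
by rewrite /= nth_mkseq ?letter_eq0 ?iI // ltnW.
Qed.

Lemma stip_code_valid g : valid (stip_code g).
Proof. exact: code_valid (stip_sub_ip g). Qed.

Lemma stip_code_stip0 : stip_code stip0 = [::].
Proof.
apply/eqP; rewrite -size_eq0 size_stip_code cardfs_eq0 /=.
by rewrite fcover0.
Qed.

Lemma stip_code_block n : stip_code (block n) = 1 :: nseq (val n).-1 2.
Proof. by rewrite /stip_code /= fcover1 card_seg code_block. Qed.

Lemma stip_code_bullet s t : stip_code (bullet_basis s t) = stip_code s ++
  stip_code t.
Proof.
have [sst <-] := sub_ip_shift (stip_sub_ip s) (stip_sub_ip t).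
rewrite /stip_code; suff -> : #|` fcover (bullet_basis s t)| =
  #|` fcover s| + #|` fcover t| by [].
have -> : fcover (bullet_basis s t) = seg (#|` fcover s| + #|` fcover t|).
  apply/fsetP => x; rewrite fcoverU fcover_shift !mem_fcover_stip in_seg.
  rewrite subn_gt0 leq_subLR; have [xs|sx] := leqP x #|` fcover s|.
    by rewrite !andbT andbF orbF (leq_trans xs) ?leq_addr ?andbT.
  by rewrite andbF /= (ltnW sx) (leq_ltn_trans _ sx).
exact: card_seg.
Qed.

Lemma rank0 (A : {fset nat}) : 0 \notin A -> rank A 0 = 0.
Proof.
move=> A0; apply/eqP; rewrite cardfs_eq0; apply/eqP/fsetP => y.
by rewrite !inE /= leqn0; apply/negP => /andP[+ /eqP y0]; rewrite y0 (negPf A0).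
Qed.

(** [m] need not lie in [A]: its rank is then that of the last element of [A] below it, if any. No
    block crosses such a gap, so the link is absent on both sides. *)
Lemma linked_std A I m : is_ip A I -> m.+1 \in A ->
  linked (std_val A I) (rank A m) = linked I m.
Proof.
move=> ipI mA; case/is_ipP: (ipI) => cI _ iI.
have inA E x : E \in I -> x \in E -> x \in A.
  by move=> EI xE; rewrite -cI; apply/in_fcover; exists E.
have rE : rank A m.+1 = (rank A m).+1 by rewrite rankS mA addn1.
apply/linkedP/linkedP => [[_ /imfsetP[/= E EI ->] []]|[E EI [mE m1E]]].
  rewrite -rE => /imfsetP[y /= yE rmy] /imfsetP[x /= xE /rank_inj mx].
  have {mx}m1E : m.+1 \in E by rewrite mx // (inA E).
  exists E => //; split=> //.
  (* [y] lies in [E] and has the same rank as [m]; once [y <= m], the interval [E] contains [m]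
     along with [y] and [m.+1]. *)
  have ym : y <= m.
    rewrite leqNgt; apply/negP => /(leq_rank A); rewrite -rmy rE ltnn //.
  case/is_intervalP: (iI _ EI) m1E yE => a [b [_ ->]].
  rewrite !Defs.in_itv => /andP[_ mb] /andP[ay _].
  by rewrite (leq_trans ay ym) ltnW.
exists (rank A @` E); first by apply: in_imfset.
by rewrite -rE; split; apply/imfsetP; [exists m|exists m.+1].
Qed.

Lemma stip_code_std A (I : IP A) n : A `<=` seg n ->
  stip_code (std I) = nonzeros (code n (val I)).
Proof.
move=> /fsubsetP An; have ipI : is_ip A (val I) by rewrite -mem_IP (valP I).
have A0 : 0 \notin A by apply/negP => /An; rewrite in_seg.
have cI : fcover (val I) = A by case/is_ipP: ipI.
have cS : fcover (std I) = seg #|` A| by case/is_ipP: (std_ip I).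
(* Induction on prefixes: among the first [m] letters, one is kept for each element of [A] up to
   [m], and [linked_std] shows that kept letters do not change. *)
have main m : nonzeros (code m (val I)) = code (rank A m) (std_val A (val I)).
  elim: m => [|m IH]; first by rewrite rank0.
  rewrite /code mkseqS filter_rcons -/(code m _) IH letter_eq0 negbK cI rankS.
  case: (boolP (_ \in A)) => mA; last by rewrite addn0.
  rewrite addn1 mkseqS -/(code _ _); congr rcons.
  rewrite /letter linked_std // cI mA; congr (nat_of_bool _ + _).
  rewrite [fcover _]cS; have : rank A m.+1 \in seg #|` A|.
    by rewrite -rank_imfset; apply: in_imfset.
  by rewrite rankS mA addn1 => ->.
rewrite main /stip_code cS card_seg; congr (code _ _).
rewrite /rank; congr #|` _|; apply/fsetP => x; rewrite !inE /= andb_idr //.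
by move=> /An; rewrite in_seg => /andP[].
Qed.

(** That gluing yields an interval partition is obtained indirectly: the maximum of the codes is
    valid, hence the code of some [K], and [glue_linked] identifies [K] with the glued partition. *)
Lemma sub_ipU A B I J n : is_ip A I -> is_ip B J -> A `<=` seg n -> B `<=` seg n ->
  exists2 K, sub_ip n K & [/\ glue I J = K, fcover K = A `|` B
    & [seq maxn p.1 p.2 | p <- zip (code n I) (code n J)] = code n K].
Proof.
move=> ipI ipJ An Bn; case/is_ipP: (ipI) => cI _ _; case/is_ipP: (ipJ) => cJ _ _.
have sI : sub_ip n I by rewrite /sub_ip cI ipI.
have sJ : sub_ip n J by rewrite /sub_ip cJ ipJ.
pose c := [seq maxn p.1 p.2 | p <- zip (code n I) (code n J)].
have sc : size c = n by rewrite size_map size_zip !size_mkseq minnn.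
have cd : (code n I, code n J) \in decs c.
  by rewrite mem_decs !code_lt3 !size_mkseq !eqxx.
have c3 : all (gtn 3) c.
  apply/(all_nthP 0) => i; rewrite sc => ni.
  rewrite (nth_map (0, 0)) ?size_zip ?size_mkseq ?minnn //.
  by rewrite nth_zip ?size_mkseq //= !nth_mkseq // gtn_max !letter_lt3.
have vc := decs_valid cd (erefl : 0 = maxn 0 0) (code_valid sI) (code_valid sJ).
have [K] := exists_code c3 vc; rewrite sc => sK cK.
exists K => //; have [cKU lK] := (code_max sI sJ sK).1 (esym cK).
split; [|by rewrite cKU cI cJ|by rewrite cK].
have ipK : is_ip (fcover K) K by case/andP: sK.
by apply: glue_linked ipI ipJ ipK _ lK; rewrite cKU cI cJ.
Qed.

End Standardization.

(** * The coproduct in terms of codes *)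

Section DeltaSpade.

Definition stip_of (w : seq posn) : stip :=
  foldr (fun n s => bullet_basis (block n) s) stip0 w.

Lemma stip_code_stip_of w : stip_code (stip_of w) = bits w.
Proof. by elim: w => [|n w IH] /=;
  rewrite ?stip_code_stip0 // stip_code_bullet stip_code_block IH. Qed.

Lemma stip_ofK g : stip_of (unbits (stip_code g)) = g.
Proof. by apply: stip_code_inj; rewrite stip_code_stip_of unbitsK
  ?stip_code_bounds ?stip_code_valid. Qed.

Lemma stip_of_unbitsK w : unbits (stip_code (stip_of w)) = w.
Proof. by rewrite stip_code_stip_of bitsK. Qed.

Lemma stip_of_cat u v : stip_of (u ++ v) = bullet_basis (stip_of u) (stip_of v).
Proof. by apply: stip_code_inj; rewrite stip_code_bullet !stip_code_stip_of
  bits_cat. Qed.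

Definition sub_ips n : {fset {fset {fset nat}}} :=
  [fset I in fpowerset (fpowerset (seg n)) | sub_ip n I].

Lemma mem_sub_ips n I : (I \in sub_ips n) = sub_ip n I.
Proof.
rewrite !inE /= andb_idl // => /andP[/is_ipP[_ _ _] /fsubsetP In].
rewrite fpowersetE; apply/fsubsetP => E EI; rewrite fpowersetE.
by apply/fsubsetP => x xE; apply: In; apply/in_fcover; exists E.
Qed.

(** A partition determines its ground set, so the double sum meets each partition once. *)
Lemma big_IP (M : nmodType) n (F : {fset {fset nat}} -> M) :
  (\sum_(A <- fpowerset (seg n)) \sum_(I <- IP A) F I =
   \sum_(I <- sub_ips n) F I)%R.
Proof.
transitivity (\sum_(A <- fpowerset (seg n))
    \sum_(I <- sub_ips n | fcover I == A) F I)%R.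
  rewrite big_seq_cond [RHS]big_seq_cond; apply: eq_bigr => A.
  rewrite andbT fpowersetE => An; rewrite [RHS]big_fset_condE; apply: eq_fbigl => I.
  have := mem_sub_ips n I; rewrite mem_IP !inE /= => ->.
  apply/idP/andP => [ipI|[/andP[ipI _] /eqP <- //]].
  by case/is_ipP: (ipI) => cI _ _; rewrite /sub_ip cI eqxx ipI An.
rewrite (exchange_big_dep xpredT) //= big_seq [RHS]big_seq.
apply: eq_bigr => I; rewrite mem_sub_ips => /andP[_ In].
rewrite -big_filter; have -> : [seq A <- fpowerset (seg n) | fcover I == A] =
    [:: fcover I].
  under eq_filter do rewrite eq_sym.
  by rewrite filter_pred1_uniq ?fset_uniq // fpowersetE.
by rewrite big_seq1.
Qed.

(** Codes map the pairs of partitions gluing to [g] bijectively onto the pairs of valid words with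
    maximum [stip_code g]. *)
Lemma Delta_spade_decs g : Delta_spade g =
  (\sum_(p <- decs (stip_code g) | valid p.1 && valid p.2)
    << (stip_of (unbits (nonzeros p.1)), stip_of (unbits (nonzeros p.2))) >>)%R.
Proof.
set n := #|` fcover g|; have gn : fcover g = seg n := fcover_stip g.
pose st a : stip := stip_of (unbits (nonzeros a)).
pose F I J : {malg rat[(stip * stip)%type]} :=
  (<< (st (code n I), st (code n J)) >>)%R.
have stE A (I : IP A) : A `<=` seg n -> std I = st (code n (val I)).
  move=> An; rewrite /st -stip_code_std // -[LHS]stip_ofK //.
transitivity (\sum_(A <- fpowerset (seg n)) \sum_(A' <- fpowerset (seg n))
    \sum_(I <- IP A) \sum_(J <- IP A' | glue I J == g) F I J)%R.
  rewrite /Delta_spade gn big_seq_cond [RHS]big_seq_cond.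
  apply: eq_bigr => A; rewrite andbT fpowersetE => An.
  rewrite big_mkcond big_seq_cond [RHS]big_seq_cond.
  apply: eq_bigr => A'; rewrite andbT fpowersetE => An'.
  case: ifP => [_|AA'].
    rewrite [RHS]big_seq_fsetE; apply: eq_bigr => I _.
    rewrite [RHS]big_seq_fsetE.
    by apply: eq_bigr => J _; rewrite !stE.
  (* The condition on [A] and [A'] may be dropped: a gluing has their union as ground set, so it
     equals [g] only if the condition holds. *)
  rewrite big_seq big1 // => I; rewrite mem_IP => ipI.
  rewrite big_seq_cond big1 // => J; rewrite mem_IP => /andP[ipJ /eqP gE].
  have [K _ [glK cK _]] := sub_ipU ipI ipJ An An'.
  by rewrite -cK -glK gE gn eqxx in AA'.
pose FI I := (\sum_(J <- sub_ips n | glue I J == g) F I J)%R.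
transitivity (\sum_(I <- sub_ips n) FI I)%R.
  rewrite -big_IP; apply: eq_bigr => A _; rewrite exchange_big /=.
  apply: eq_bigr => I _; rewrite /FI [RHS]big_mkcond -big_IP.
  by apply: eq_bigr => A' _; rewrite big_mkcond.
pose L := [seq (X, Y) | X : {fset {fset nat}} <- sub_ips n, Y : {fset {fset
  nat}} <- sub_ips n].
pose sc (p : {fset {fset nat}} * {fset {fset nat}}) := (code n p.1, code n p.2).
have Lsc : perm_eq [seq sc p | p <- L & glue p.1 p.2 == g]
    [seq p <- decs (stip_code g) | valid p.1 && valid p.2].
  have inL p : p \in L -> sub_ip n p.1 /\ sub_ip n p.2.
    by move=> /allpairsP[[I J] /= [+ + ->]]; rewrite !mem_sub_ips.
  have sg : sub_ip n g := stip_sub_ip g.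
  apply: uniq_perm.
  - rewrite map_inj_in_uniq.
      apply: filter_uniq; apply: allpairs_uniq; rewrite ?fset_uniq //.
      by move=> [I J] [I' J'] _ _ [-> ->].
    move=> [I J] [I' J']; rewrite !mem_filter.
    move=> /andP[_ /inL[/= sI sJ]] /andP[_ /inL[/= sI' sJ']] [II' JJ'].
    by rewrite (code_inj sI sI' II') (code_inj sJ sJ' JJ').
  - exact: filter_uniq (decs_uniq _).
  move=> [a b]; rewrite mem_filter mem_decs /=; apply/mapP/idP.
    move=> [[I J]]; rewrite mem_filter /= => /andP[/eqP gE /inL[/= sI sJ]] [-> ->].
    rewrite !code_lt3 !code_valid // !size_mkseq eqxx /=.
    case/andP: (sI) => ipI In; case/andP: (sJ) => ipJ Jn.
    have [K _ [glK _ ->]] := sub_ipU ipI ipJ In Jn.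
    by rewrite -glK gE /stip_code -/n.
  move=> /andP[/andP[va vb] /and4P[a3 b3 /eqP sab /eqP abg]].
  have sa : size a = n.
    by rewrite -[RHS](size_stip_code g) -abg size_map size_zip -sab minnn.
  have [I] := exists_code a3 va; have [J] := exists_code b3 vb.
  rewrite -sab sa => sJ cJ sI cI; exists (I, J); last by rewrite /sc /= cI cJ.
  rewrite mem_filter /=; apply/andP; split; last first.
    by apply: allpairs_f; rewrite mem_sub_ips.
  case/andP: (sI) => ipI In; case/andP: (sJ) => ipJ Jn.
  have [K sK [-> _]] := sub_ipU ipI ipJ In Jn.
  rewrite cI cJ abg => gK; apply/eqP; apply: (code_inj sK sg).
  by rewrite -gK.
rewrite -[RHS]big_filter -(perm_big _ Lsc) big_map big_filter /L.
rewrite [RHS]big_mkcond big_allpairs_dep /=; apply: eq_bigr => I _.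
by rewrite /FI big_mkcond; apply: eq_bigr.
Qed.

Lemma Delta_spade_words (w : word) : Delta_spade (stip_of w) =
  (\sum_(p <- word_splits w) << (stip_of p.1, stip_of p.2) >>)%R.
Proof. by rewrite Delta_spade_decs stip_code_stip_of big_word_splits. Qed.

End DeltaSpade.

(** * The bialgebras of words *)

Local Open Scope ring_scope.

Lemma linear_sumP (U V : lmodType rat) (F : U -> V) (I : Type) (r : seq I)
    (P : pred I) (G : I -> U) : linear F ->
  F (\sum_(i <- r | P i) G i) = \sum_(i <- r | P i) F (G i).
Proof.
move=> lF; pose FL : {linear U -> V} :=
  HB.pack F (GRing.isLinear.Build rat U V _ F lF).
exact: (linear_sum FL).
Qed.

(** The pairing is non-degenerate. This makes an arbitrary [Delta] of the theorem equal to
    [Delta_wrd]. *)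
Lemma eq_dual_coproduct (K : choiceType) mul (D D' : {malg rat[K]} -> _) :
  dual_coproduct mul D -> dual_coproduct mul D' -> D =1 D'.
Proof.
move=> [_ DM] [_ DM'] x; apply: eq_pairing => -[u v].
by rewrite -tensU DM DM'.
Qed.

Lemma dual_coproduct_basis (K : choiceType) mul (D : {malg rat[K]} -> _) :
  (forall y, linear (mul^~ y)) -> (forall x, linear (mul x)) -> linear D ->
  (forall k u v, (D << k >>)@_(u, v) = (mul << u >> << v >>)@_k) ->
  dual_coproduct mul D.
Proof.
move=> ml mr lD DM; split=> // x v w.
apply: (eq_linear_basis (M := rat^o) (F := fun x => pairing (D x) (tens v w))
  (G := fun x => pairing x (mul v w))) => [a y z|a y z|k] /=.
- by rewrite lD pairingPl.
- by rewrite pairingPl.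
apply: (eq_bilinear_basis (M := rat^o)
  (F := fun v w => pairing (D << k >>) (tens v w))
  (G := fun v w => pairing << k >> (mul v w)))
  => {v w} [w a v v'|v a w w'|w a v v'|v a w w'|u v] /=.
- by rewrite tensPl pairingPr.
- by rewrite tensPr pairingPr.
- by rewrite ml pairingPr.
- by rewrite mr pairingPr.
- by rewrite tensU pairingUr pairingU DM.
Qed.

Local Notation nilw := (FMonom [::] : word).

Lemma TV1E : 1 = << nilw >> :> TV.
Proof. by congr mkmalgU; apply: fmoneE. Qed.

Lemma TVME x y :
  x * y = bilext (fun u v : word => << FMonom (u ++ v) >>) x y :> TV.
Proof.
rewrite malgME /bilext /linext; apply: eq_bigr => u _.
rewrite scaler_sumr; apply: eq_bigr => v _.
rewrite [mmul u v]fmmulE scalerA; apply/malgP => w.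
by rewrite mcoeffZ !mcoeffU mulr_natr.
Qed.

Lemma TVMUU (u v : word) : << u >> * << v >> = << FMonom (u ++ v) >> :> TV.
Proof. by rewrite TVME bilextU. Qed.

Lemma TVMl (y : TV) : linear (fun x => x * y).
Proof. by move=> a x z; rewrite !TVME bilextPl. Qed.

Lemma TVMr (x : TV) : linear (fun y => x * y).
Proof. by move=> a y z; rewrite !TVME bilextPr. Qed.

Lemma counitU w : counit << w >> = (w == nilw)%:R.
Proof. exact: mcoeffU. Qed.

Lemma word_bialgebra (D : TV -> {malg rat[(word * word)%type]}) :
  linear D -> (forall w, D << w >> = \sum_(p <- word_splits w) << p >>) ->
  is_bialgebra *%R 1 D counit.
Proof.
move=> lD DU; have lc : scalar counit.
  by move=> a x y; rewrite /counit mcoeffD mcoeffZ.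
split.
- split; [exact: TVMl|exact: TVMr|exact: mulrA|exact: mul1r|exact: mulr1].
- split; [exact: lD|exact: lc| | |].
  + apply: eq_linear_basis => [a x y|a x y|w].
    * by rewrite lD tensmap_linear /tensA linearP.
    * by rewrite lD tensmap_linear.
    rewrite DU !(linear_sumP _ _ _ (tensmap_linear _ _)).
    rewrite /tensA (linear_sumP _ _ _ (linext_linear _)).
    transitivity (\sum_(p <- word_splits w) \sum_(q <- word_splits p.1)
        << (q.1, (q.2, p.2)) >> : {malg rat[(word * (word * word))%type]}).
      apply: eq_bigr => -[u v] _; rewrite tensmapU /= DU.
      rewrite (linear_sumP _ _ _ (tensPl _)) (linear_sumP _ _ _ (linext_linear _)).
      by apply: eq_bigr => p _; rewrite tensU linextU.
    rewrite (word_splits_coassoc (fun u v w => << (u, (v, w)) >>)).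
    apply: eq_bigr => -[u v] _; rewrite tensmapU /= DU.
    rewrite (linear_sumP _ _ _ (tensPr _)).
    by apply: eq_bigr => -[p q] _; rewrite tensU.
  + apply: eq_linear_basis => [a x y|//|w]; first by rewrite lD linearP.
    rewrite DU (linear_sumP _ _ _ (linext_linear _)).
    rewrite -(word_splits_counitl (fun u => << u >>) w).
    apply: eq_bigr => p _; rewrite linextU counitU.
    by case: eqP => _; rewrite ?scale1r ?scale0r.
  + apply: eq_linear_basis => [a x y|//|w]; first by rewrite lD linearP.
    rewrite DU (linear_sumP _ _ _ (linext_linear _)).
    rewrite -(word_splits_counitl (fun u => << u >>) w).
    rewrite (big_word_splitsC (fun u v => if u == nilw then << v >> else 0)).
    apply: eq_bigr => p _; rewrite linextU counitU.
    by case: eqP => _; rewrite ?scale1r ?scale0r.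
- apply: eq_bilinear_basis => [y a x z|x a y z|y a x z|x a y z|u v].
  + by rewrite TVMl lD.
  + by rewrite TVMr lD.
  + by rewrite lD tensmulPl.
  + by rewrite lD tensmulPr.
  rewrite TVMUU !DU (linear_sumP _ _ _ (tensmulPl _ _)).
  transitivity (\sum_(p <- word_splits (FMonom (u ++ v))) << (p.1, p.2) >>
      : {malg rat[(word * word)%type]}).
    by apply: eq_bigr => -[].
  rewrite (word_splits_mul (fun u v => << (u, v) >>)).
  apply: eq_bigr => p _; rewrite (linear_sumP _ _ _ (tensmulPr _ _)).
  by apply: eq_bigr => q _; rewrite tensmulU !TVMUU tensU.
- by rewrite TV1E DU word_splits_nil big_seq1 tensU.
- apply: (eq_bilinear_basis (M := rat^o) (F := fun x y => counit (x * y))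
    (G := fun x y => counit x * counit y))
    => [y a x z|x a y z|y a x z|x a y z|u v] /=.
  + by rewrite TVMl lc.
  + by rewrite TVMr lc.
  + by rewrite lc mulrDl -mulrA.
  + by rewrite lc mulrDr mulrCA.
  + rewrite TVMUU !counitU -natrM mulnb; congr (nat_of_bool _)%:R.
    by case: u v => [[|i u]] [[|j v]].
- by rewrite TV1E counitU eqxx.
Qed.

Lemma deconc_linear : linear deconc.
Proof. exact: linext_linear. Qed.

Lemma deconcU (w : word) : deconc << w >> =
  \sum_(i < (size w).+1) << (FMonom (take i w), FMonom (drop i w)) >>.
Proof. exact: linextU. Qed.

(** Only the cut after [size u] letters can produce [(u, v)], and it does so exactly when the word
    is [u ++ v]. *)
Lemma deconc_dual : dual_coproduct *%R deconc.
Proof.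
apply: dual_coproduct_basis => [||| w u v];
  [exact: TVMl|exact: TVMr|exact: deconc_linear|].
rewrite deconcU TVMUU mcoeffU raddf_sum /=.
have termE (i : 'I_(size w).+1) :
    (<< (FMonom (take i w), FMonom (drop i w)) >> : {malg rat[(word *
      word)%type]})@_(u, v) =
    if (i == size u :> nat) && (FMonom (u ++ v) == w) then 1 else 0.
  rewrite mcoeffU xpair_eqE; case: (boolP (_ && _)) => [/andP[/eqP<- /eqP<-]|nuv].
    by rewrite /= size_takel ?eqxx ?cat_take_drop ?fmK ?eqxx // -ltnS.
  case: (boolP (_ && _)) => // /andP[/eqP iu /eqP wE].
  by move: nuv; rewrite iu -wE /= take_size_cat // drop_size_cat // !fmK !eqxx.
rewrite (eq_bigr _ (fun i _ => termE i)) -big_mkcond /=.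
case: (boolP (FMonom (u ++ v) == w)) => [/eqP wE|_]; last first.
  by rewrite big_pred0 // => i; rewrite andbF.
have uw : (size u < (size w).+1)%N by rewrite -wE /= size_cat ltnS leq_addr.
by rewrite (big_pred1 (Ordinal uw)) // => i; rewrite andbT.
Qed.

(** * Antipode and length filtration for deconcatenation *)

Lemma size_recursion (T U : Type) (u0 : U) (E : (seq T -> U) -> seq T -> U) :
  (forall s s' w, (forall v, (size v < size w)%N -> s v = s' v) ->
     E s w = E s' w) ->
  exists s, forall w, s w = E s w.
Proof.
(* Iterating [E] more than [size w] times makes the value at [w] stable; [u0] is a dummy start. *)
move=> Eloc; pose it n := iter n E (fun=> u0).
have itE n m w : (size w < n)%N -> (size w < m)%N -> it n w = it m w.
  elim: n m w => [//|n IH] [//|m] w wn wm; apply: Eloc => v vw.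
  by apply: IH; apply: leq_trans vw _.
exists (fun w => it (size w).+1 w) => w; apply: Eloc => v vw.
exact: itE.
Qed.

Lemma deconc_antipode (mul : TV -> TV -> TV) : is_algebra mul 1 ->
  is_coalgebra deconc counit ->
  exists S, is_antipode mul 1 deconc counit S.
Proof.
move=> alg coalg; case: (alg) => ml mr _ mul1 mulr1.
(* Each recursion solves one antipode identity at [w] for the term in which [s] meets the entire
   word: the last cut for [El], the first one for [Er]. The other cuts involve shorter words
   only. *)
pose El (s : seq posn -> TV) w := if w is [::] then 1 else
  - \sum_(i < size w) mul (s (take i w)) << FMonom (drop i w) >>.
pose Er (s : seq posn -> TV) w := if w is [::] then 1 else
  - \sum_(i < size w) mul << FMonom (take i.+1 w) >> (s (drop i.+1 w)).
have [sl slE] : exists s, forall w, s w = El s w.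
  apply: (size_recursion 1) => s s' [//|n w] ss'; congr (- _).
  apply: eq_bigr => i _; rewrite ss' // size_takel //; exact: ltnW.
have [sr srE] : exists s, forall w, s w = Er s w.
  apply: (size_recursion 1) => s s' [//|n w] ss'; congr (- _).
  apply: eq_bigr => i _; rewrite ss' // size_drop /= subSS ltnS leq_subr //.
pose Sl := linext (fun w : word => sl w); pose Sr := linext (fun w : word => sr w).
exists Sl; apply: (antipode_of_one_sided alg coalg (Sr := Sr)).
- exact: linext_linear.
- exact: linext_linear.
- apply: eq_linear_basis => [||w]; first exact: (conv_linear _ coalg).
    by move=> a x y; rewrite /counit mcoeffD mcoeffZ scalerDl scalerA.
  rewrite /conv deconcU (linear_sumP _ _ _ (linext_linear _)) counitU.
  under eq_bigr do rewrite linextU /= /Sl linextU.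
  rewrite big_ord_recr /= take_size drop_size -TV1E mulr1 slE.
  case: w => [[|n w]] /=; first by rewrite big_ord0 add0r ?eqxx scale1r.
  by rewrite addrN scale0r.
- apply: eq_linear_basis => [||w]; first exact: (conv_linear _ coalg).
    by move=> a x y; rewrite /counit mcoeffD mcoeffZ scalerDl scalerA.
  rewrite /conv deconcU (linear_sumP _ _ _ (linext_linear _)) counitU.
  under eq_bigr do rewrite linextU /= /Sr linextU.
  rewrite big_ord_recl /= take0 drop0 -TV1E mul1 srE.
  case: w => [[|n w]] /=; first by rewrite big_ord0 addr0 ?eqxx scale1r.
  by rewrite addNr scale0r.
Qed.

Lemma len_filtrationP n x :
  len_filtration n x <-> forall w : word, x@_w != 0 -> (size w <= n)%N.
Proof. by split=> xn w; [rewrite mcoeff_neq0|rewrite -mcoeff_neq0]; apply: xn. Qed.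

Lemma len_filtration_linear n : subspace (len_filtration n).
Proof.
split=> [|a x y /len_filtrationP xn /len_filtrationP yn]; apply/len_filtrationP => w.
  by rewrite mcoeff0 eqxx.
rewrite mcoeffD mcoeffZ; have [x0|/xn //] := eqVneq x@_w 0.
by rewrite x0 mulr0 add0r => /yn.
Qed.

Lemma deconc_filtered n x : len_filtration n x ->
  exists z : 'I_n.+1 -> {malg rat[(word * word)%type]},
    (forall p : 'I_n.+1,
       tens_space (len_filtration p) (len_filtration (n - p)) (z p)) /\
    deconc x = \sum_p z p.
Proof.
move=> xn; pose t p (w : word) : {malg rat[(word * word)%type]} :=
  << (FMonom (take p w), FMonom (drop p w)) >>.
(* The [p]-th summand collects the cuts after exactly [p] letters. For [p] beyond the length,
   [take p w] is [w] again, so without the bound the final cut would be repeated. *)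
exists (fun p => \sum_(w <- msupp x | (p <= size w)%N) x@_w *: t p w); split.
  move=> p; exists [seq (x@_w *: << FMonom (take p w) >>, << FMonom (drop p w) >>)
    | w : word <- msupp x & (p <= size w)%N]; split.
    move=> u /mapP[w]; rewrite mem_filter => /andP[pw wx] -> /=.
    split; apply/len_filtrationP => v; rewrite ?mcoeffZ mcoeffU.
      case: (_ =P v) => [<- _|_]; last by rewrite mulr0 eqxx.
      by rewrite /= size_takel.
    case: (_ =P v) => [<- _|_]; last by rewrite eqxx.
    by rewrite /= size_drop leq_sub2r // (xn w).
  rewrite big_map big_filter; apply: eq_bigr => w _ /=.
  have := tensPl << FMonom (drop p w) >> x@_w << FMonom (take p w) >> 0.
  have t0 : tens 0 << FMonom (drop p w) >> = 0 :> {malg rat[(word * word)%type]}.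
    by rewrite /tens /bilext linear0.
  by rewrite /= t0 !addr0 tensU => ->.
rewrite (exchange_big_dep xpredT) //= [LHS]/deconc /linext.
rewrite big_seq [RHS]big_seq; apply: eq_bigr => w /xn wn; rewrite scaler_sumr.
rewrite (big_ord_widen n.+1 (fun i => x@_w *: t i w)) ?ltnS //.
Qed.

Lemma len_filtration_connected : is_connected len_filtration.
Proof.
exists 1 => [|x]; first exact: oner_neq0.
rewrite len_filtrationP; split=> [x0|[c ->] w].
  exists x@_nilw; apply/malgP => w; rewrite mcoeffZ TV1E mcoeffU.
  have [<-|nw] := eqVneq nilw w; first by rewrite mulr1.
  rewrite mulr0; apply/eqP; apply: contraNT nw => /x0.
  by rewrite leqn0 size_eq0 fmP eq_sym.
rewrite mcoeffZ TV1E mcoeffU; case: (_ =P w) => [<- //|_].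
by rewrite mulr0 eqxx.
Qed.

(** By [spade_finite] the formally infinite sum runs over a finite set [S], so its coefficients can
    be read off term by term. *)
Lemma mcoeff_spade_basis s t g :
  (spade_basis s t)@_g = (Delta_spade g)@_(s, t).
Proof.
have /finite_fsetP[S SE] := spade_finite s t.
have inS h : (h \in S) = ((Delta_spade h)@_(s, t) != 0).
  rewrite -pairingU -tensU; apply/idP/idP => hS.
    by have := congr1 (fun A => A h) SE => /= ->.
  by have := congr1 (fun A => A h) SE => /= <-.
rewrite /spade_basis (fsbigTE S) => [|h]; last first.
  by rewrite inS negbK tensU pairingU => /eqP ->; rewrite scale0r.
rewrite raddf_sum /=; under eq_bigr do rewrite mcoeffZ mcoeffU tensU pairingU.
have [gS|gS] := boolP (g \in S); last first.
  rewrite big1_seq => [|h /andP[_ hS]].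
    by move: gS; rewrite inS negbK => /eqP.
  by case: (_ =P g) hS gS => [-> ->//|_ _ _]; rewrite mulr0.
rewrite (big_fsetD1 g gS) /= eqxx mulr1 big1_seq ?addr0 // => h.
by rewrite in_fsetD1 => /andP[_ /andP[/negPf -> _]]; rewrite mulr0.
Qed.

(** * The isomorphism with interval partitions and the transported product *)

Section Phi.
Variable Phi : {linear TV -> Hint}.
Hypothesis PhiP : is_Phi Phi.

Lemma PhiU (w : word) : Phi << w >> = << stip_of w >>.
Proof.
case: PhiP => Phi1 PhiM Phin; case: w; elim=> [|n w IH]; first by rewrite -TV1E.
have -> : << FMonom (n :: w) >> = << FMonom [:: n] >> * << FMonom w >> :> TV.
  by rewrite TVMUU.
by rewrite PhiM Phin IH /bullet bilextU.
Qed.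

Lemma mcoeff_Phi x (w : word) : (Phi x)@_(stip_of w) = x@_w.
Proof.
apply: (eq_linear_basis (M := rat^o) (F := fun x => (Phi x)@_(stip_of w))
  (G := fun x => x@_w)) => [a y z|a y z|u] /=.
- by rewrite linearP mcoeffD mcoeffZ.
- by rewrite mcoeffD mcoeffZ.
rewrite PhiU !mcoeffU; congr (1 *+ nat_of_bool _).
apply/eqP/eqP => [E|-> //]; rewrite -[u]fmK -[w]fmK; congr FMonom.
by apply: bits_inj; rewrite -!stip_code_stip_of E.
Qed.

Lemma Phi_bijective : bijective Phi.
Proof.
exists (linext (fun g => << word_of_code (stip_code g) >>)).
  apply: eq_linear_basis => [a x y|//|w]; first by rewrite !linearP.
  by rewrite PhiU linextU /word_of_code stip_of_unbitsK fmK.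
apply: eq_linear_basis => [a x y|//|g]; first by rewrite !linearP.
by rewrite linextU PhiU /word_of_code stip_ofK.
Qed.

Variable Phi' : Hint -> TV.
Hypothesis PhiK' : cancel Phi' Phi.

Definition spade_wrd v w := Phi' (spade (Phi v) (Phi w)).

(** [Phi'] is a bare function; its values are read off after applying [Phi], which matches the two
    bases. Bilinearity of the product is then checked on coefficients. *)
Lemma mcoeff_spade_wrd v w (k : word) :
  (spade_wrd v w)@_k = (spade (Phi v) (Phi w))@_(stip_of k).
Proof. by rewrite -[in RHS](PhiK' (spade _ _)) mcoeff_Phi. Qed.

Lemma spade_wrd_linearl w : linear (spade_wrd^~ w).
Proof.
move=> a x y; apply/malgP => k; rewrite mcoeffD mcoeffZ !mcoeff_spade_wrd.
by rewrite linearP /spade bilextPl mcoeffD mcoeffZ.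
Qed.

Lemma spade_wrd_linearr v : linear (spade_wrd v).
Proof.
move=> a x y; apply/malgP => k; rewrite mcoeffD mcoeffZ !mcoeff_spade_wrd.
by rewrite linearP /spade bilextPr mcoeffD mcoeffZ.
Qed.

Definition Delta_wrd : TV -> {malg rat[(word * word)%type]} :=
  linext (fun w : word => \sum_(p <- word_splits w) << p >>).

Lemma Delta_wrd_linear : linear Delta_wrd.
Proof. exact: linext_linear. Qed.

Lemma Delta_wrdU w : Delta_wrd << w >> = \sum_(p <- word_splits w) << p >>.
Proof. exact: linextU. Qed.

Lemma Delta_wrd_dual : dual_coproduct spade_wrd Delta_wrd.
Proof.
apply: dual_coproduct_basis => [||| k u v]; [exact: spade_wrd_linearl
  |exact: spade_wrd_linearr|exact: Delta_wrd_linear|].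
rewrite mcoeff_spade_wrd !PhiU /spade bilextU mcoeff_spade_basis.
rewrite Delta_spade_words Delta_wrdU !raddf_sum /=; apply: eq_bigr => p _.
rewrite !mcoeffU; congr (1 *+ nat_of_bool _).
have inj (x y : word) : (stip_of x == stip_of y) = (x == y).
  apply/eqP/eqP => [E|-> //]; rewrite -[x]fmK -[y]fmK; congr FMonom.
  by apply: bits_inj; rewrite -!stip_code_stip_of E.
by rewrite !xpair_eqE !inj.
Qed.

Lemma spade_wrd_filtered : is_filtered spade_wrd deconc len_filtration.
Proof.
split.
- exact: len_filtration_linear.
- by move=> n x xn w /xn wn; apply: leqW.
- move=> x; exists (\max_(w <- msupp x) size (w : word))%N => w wx.
  exact: (leq_bigmax_seq _ wx).
- move=> p q x y /len_filtrationP xp /len_filtrationP yq.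
  (* The coefficient of [w] in the product pairs the splits of [w] with [x] and [y]. If [w] is
     longer than [p + q], each split has a part too long for [x] or for [y]. *)
  apply/len_filtrationP => w; rewrite -pairingU.
  case: Delta_wrd_dual => _ <-; rewrite Delta_wrdU.
  have lin : linear (fun z => pairing z (tens x y) : rat^o).
    exact: pairingPl.
  rewrite (linear_sumP (V := rat^o) _ _ _ lin); apply: contraR; rewrite -ltnNge.
  move=> pqw; apply/eqP; apply: big1_seq => -[u v] /andP[_ /word_splits_size wuv].
  rewrite pairingU mcoeff_tens; have [/eqP->|/xp up] := boolP (x@_u == 0).
    exact: mul0r.
  have [/eqP->|/yq vq] := boolP (y@_v == 0); first exact: mulr0.
  have := leq_trans pqw wuv; rewrite ltnNge => /negP[].
  exact: leq_add.
- exact: deconc_filtered.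
Qed.

End Phi.

Theorem mainTheorem9 :
  (exists Phi : {linear TV -> Hint}, is_Phi Phi /\
     forall Psi : {linear TV -> Hint}, is_Phi Psi -> Psi =1 Phi) /\
  forall Phi : {linear TV -> Hint}, is_Phi Phi ->
    [/\ bijective Phi,
        exists2 f : word -> stip,
          bijective f & forall w : word, Phi << w >> = << f w >>
      & forall Phi' : Hint -> TV, cancel Phi Phi' -> cancel Phi' Phi ->
        let spade_wrd v w := Phi' (spade (Phi v) (Phi w)) in
        [/\ exists Delta, dual_coproduct spade_wrd Delta,
            dual_coproduct *%R deconc,
            forall Delta, dual_coproduct spade_wrd Delta ->
              is_bialgebra *%R 1 Delta counit
          & [/\ is_hopf spade_wrd 1 deconc counit,
                is_filtered spade_wrd deconc len_filtration
              & is_connected len_filtration]]].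
Proof.
split.
  pose Phi0 : {linear TV -> Hint} := linext (fun w : word => << stip_of w >>).
  have Phi0P : is_Phi Phi0.
    split=> [|x y|n]; first by rewrite TV1E /= linextU.
      apply: (eq_bilinear_basis (F := fun x y => Phi0 (x * y))
        (G := fun x y => bullet (Phi0 x) (Phi0 y)))
        => {x y} [y a x z|x a y z|y a x z|x a y z|u v].
      - by rewrite TVMl linearP.
      - by rewrite TVMr linearP.
      - by rewrite linearP /bullet bilextPl.
      - by rewrite linearP /bullet bilextPr.
      by rewrite TVMUU /= !linextU /bullet bilextU stip_of_cat.
    rewrite /= linextU; congr mkmalgU; apply: stip_code_inj.
    by rewrite stip_code_stip_of stip_code_block /bits /= cats0.
  exists Phi0; split=> // Psi PsiP.
  apply: eq_linear_basis => [a x y|a x y|w]; rewrite ?linearP //.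
  by rewrite (PhiU PsiP) (PhiU Phi0P).
move=> Phi PhiP; split; first exact: Phi_bijective.
  exists (fun w : word => stip_of w); last exact: PhiU.
  exists (fun g => word_of_code (stip_code g)) => [w|g]; last
    by rewrite /word_of_code stip_ofK.
  by rewrite /word_of_code stip_of_unbitsK fmK.
move=> Phi' PhiK PhiK'; rewrite -/(spade_wrd Phi Phi') => mul.
have dualD := Delta_wrd_dual PhiP PhiK'.
have bialgD := word_bialgebra Delta_wrd_linear Delta_wrdU.
split.
- by exists Delta_wrd.
- exact: deconc_dual.
- move=> D DM; apply: word_bialgebra => [|w]; first by case: DM.
  by rewrite (eq_dual_coproduct DM dualD) Delta_wrdU.
have bialg : is_bialgebra mul 1 deconc counit.
  move: bialgD; rewrite TV1E.
  apply: (dual_bialgebra dualD deconc_dual).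
    exact: (spade_wrd_linearl PhiP PhiK').
  exact: (spade_wrd_linearr PhiP PhiK').
split; last exact: len_filtration_connected.
  by split=> //; case: bialg => alg coalg _ _ _ _; apply: deconc_antipode.
exact: (spade_wrd_filtered PhiP PhiK').
Qed.
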